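(* Let $m\ge 2$, $p_1,\ldots,p_m\in[1,\infty]$, let $E$ be a Banach space, let $F$ be a Banach space of cotype $q$, and let $1\le r\le q$, with $$\frac1r-\frac1q\le\frac1{p_1}+\cdots+\frac1{p_m}<\frac1r.$$ Then there is a constant $C_m$, depending only on $m$, such that $$\left(\sum_{j_1=1}^n\left(\cdots\left(\sum_{j_m=1}^n\|vA(e_{j_1},\ldots,e_{j_m})\|_F^{s_m}\right)^{\frac{s_{m-1}}{s_m}}\cdots\right)^{\frac{s_1}{s_2}}\right)^{\frac1{s_1}}\le C_m\|A\|\,\pi_{r,1}(v)$$ for all positive integers $n$, all $m$-linear operators $A\colon\ell_{p_1}^n\times\cdots\times\ell_{p_m}^n\to E$ and all absolutely $(r,1)$-summing operators $v\colon E\to F$, with $$s_k=\begin{cases}\left[\frac1r-\left(\frac1{p_k}+\cdots+\frac1{p_m}\right)\right]^{-1}, & \text{if } k\le k_0:=\max\left\{t:\ \frac1{p_t}+\cdots+\frac1{p_m}\ge\frac1r-\frac1q\right\},\\ q, & \text{if } k>k_0.\end{cases}$$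
   Context: Banach spaces are over $\mathbb K=\mathbb R$ or $\mathbb C$; $\ell_p^n$ is $\mathbb K^n$ with the $\ell_p$ norm; $e_j$ are the canonical unit vectors; $1/\infty=0$. $\|A\|:=\sup\{\|A(z^{(1)},\ldots,z^{(m)})\|_E:\ \|z^{(j)}\|_{\ell_{p_j}^n}\le 1,\ j=1,\ldots,m\}$, and $vA$ denotes the composition $v\circ A$. $F$ has cotype $q$ ($2\le q<\infty$) if there is a constant $c$ such that $\left(\sum_{j=1}^N\|x_j\|^q\right)^{1/q}\le c\left(\mathbb E\left\|\sum_{j=1}^N\epsilon_jx_j\right\|^2\right)^{1/2}$ for all $N$ and $x_1,\ldots,x_N\in F$, where $\epsilon_j$ are independent uniform random signs. A bounded linear operator $v\colon E\to F$ is absolutely $(r,1)$-summing if there is a constant $c$ such that $\left(\sum_{j=1}^N\|v(x_j)\|^r\right)^{1/r}\le c\,\sup_{\varphi\in B_{E^*}}\sum_{j=1}^N|\varphi(x_j)|$ for all $N$ and $x_1,\ldots,x_N\in E$, where $B_{E^*}$ is the closed unit ball of the dual $E^*$; $\pi_{r,1}(v)$ is the infimum of such $c$.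
   Formalization: The constant is proved to depend only on m and on the cotype q constant of F, not on m alone; a constant depending only on m uniformly over all F is impossible (e.g. m=2, p_1=p_2=∞, r=q=2, v the identity from the projective tensor product ℓ_∞^n⊗ℓ_∞^n to ℓ_∞^{n²}). *)

(* Defs.v *)
From HB Require Import structures.
From mathcomp Require Import all_boot all_order all_algebra.
From mathcomp Require Import complex.
From mathcomp Require Import all_classical all_reals all_analysis.
Set Implicit Arguments.
Unset Strict Implicit.
Unset Printing Implicit Defensive.
Import Order.TTheory GRing.Theory Num.Theory.
Import numFieldNormedType.Exports.
Local Open Scope classical_set_scope.
Local Open Scope ring_scope.

Variant RorC := RealScalars | ComplexScalars.

Definition scalars (R : realType) (k : RorC) : numFieldType :=
  match k with RealScalars => R | ComplexScalars => R[i] end.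

(* A norm on a K-vector space is K-valued in the library, hence (for K = C) a
   complex number with zero imaginary part; exponents and suprema require
   its value in R. *)
Definition real_part (R : realType) (k : RorC) : scalars R k -> R :=
  match k with
  | RealScalars => fun x : R => x
  | ComplexScalars => fun z : R[i] => complex.Re z
  end.

Definition rnorm (R : realType) (k : RorC) (V : normedModType (scalars R k))
  (x : V) : R := real_part `|x|.

(* 1/p for p in [1, +oo]; the library's inverse satisfies (+oo)^-1 = 0. *)
Definition recip (R : realType) (p : \bar R) : R := fine (p^-1)%E.

Definition lp_norm (R : realType) (k : RorC) (n : nat) (p : \bar R)
    (x : 'rV[scalars R k]_n) : R :=
  match p with
  | a%:E => (\sum_(i < n) rnorm (x 0 i : (scalars R k)^o) `^ a) `^ a^-1
  | _ => \big[Num.max/0]_(i < n) rnorm (x 0 i : (scalars R k)^o)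
  end.

Definition multilinear (K : numFieldType) (m n : nat) (E : lmodType K)
    (A : ('I_m -> 'rV[K]_n) -> E) : Prop :=
  forall (i : 'I_m) (z : 'I_m -> 'rV[K]_n),
    linear (fun x : 'rV[K]_n => A (dfwith z i x)).

(* The supremum is over a nonempty set, bounded when A is multilinear
   because the domain is finite-dimensional. *)
Definition mult_norm (R : realType) (k : RorC) (m n : nat)
    (p : 'I_m -> \bar R) (E : normedModType (scalars R k))
    (A : ('I_m -> 'rV[scalars R k]_n) -> E) : R :=
  sup [set rnorm (A z) | z in
        [set z : 'I_m -> 'rV[scalars R k]_n | forall i, lp_norm (p i) (z i) <= 1]].

(* (E || sum_j eps_j x_j ||^2)^(1/2): the expectation over independent uniform
   signs is the average over the 2^N sign patterns. *)
Definition rademacher_L2 (R : realType) (k : RorC)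
    (F : normedModType (scalars R k)) (N : nat) (x : 'I_N -> F) : R :=
  Num.sqrt ((2 ^+ N)^-1 * \sum_(e : {ffun 'I_N -> bool})
    rnorm (\sum_(j < N) (-1) ^+ e j *: x j) ^+ 2).

Definition cotype_with (R : realType) (k : RorC) (q c : R)
    (F : normedModType (scalars R k)) : Prop :=
  forall (N : nat) (x : 'I_N -> F),
    (\sum_(j < N) rnorm (x j) `^ q) `^ q^-1 <= c * rademacher_L2 x.

Definition dual_ball (R : realType) (k : RorC)
    (E : normedModType (scalars R k)) : set {linear E -> (scalars R k)^o} :=
  [set phi | continuous phi /\ forall x, rnorm (phi x) <= rnorm x].

Definition weak_l1 (R : realType) (k : RorC)
    (E : normedModType (scalars R k)) (N : nat) (x : 'I_N -> E) : R :=
  sup [set \sum_(j < N) rnorm (phi (x j)) | phi in @dual_ball R k E].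

Definition summing_with (R : realType) (k : RorC)
    (E F : normedModType (scalars R k)) (r c : R) (v : E -> F) : Prop :=
  forall (N : nat) (x : 'I_N -> E),
    (\sum_(j < N) rnorm (v (x j)) `^ r) `^ r^-1 <= c * weak_l1 x.

Definition abs_r1_summing (R : realType) (k : RorC)
    (E F : normedModType (scalars R k)) (r : R) (v : {linear E -> F}) : Prop :=
  continuous v /\ exists c : R, summing_with r c v.

(* Without 0 <= c the infimum would be over all of R when E = 0. *)
Definition pi_r1 (R : realType) (k : RorC)
    (E F : normedModType (scalars R k)) (r : R) (v : E -> F) : R :=
  inf [set c : R | 0 <= c /\ summing_with r c v].

(* The iterated norm
     (sum_(j_0) ( ... (sum_(j_(m-1)) |f j|^(s_(m-1)))^(s_(m-2)/s_(m-1)) ...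
       )^(s_0/s_1))^(1/s_0),
   each power s_(k-1)/s_k being split as 1/s_k followed by s_(k-1). *)
Fixpoint mixed_norm (R : realType) (n m : nat) (s : nat -> R) :
    (m.-tuple 'I_n -> R) -> R :=
  match m return (m.-tuple 'I_n -> R) -> R with
  | 0 => fun f => f [tuple]
  | m'.+1 => fun f =>
      (\sum_(j < n) (mixed_norm (fun k => s k.+1)
                       (fun t : m'.-tuple 'I_n => f [tuple of j :: t])) `^ s 0%N)
        `^ (s 0%N)^-1
  end.

(* Indices are 0-based: [recip_tail p k] is 1/p_(k+1) + ... + 1/p_m in the
   usual 1-based numbering, and [k0] is one less than the usual index. *)
Definition recip_tail (R : realType) (m : nat) (p : 'I_m -> \bar R) (k : nat) : R :=
  \sum_(i < m | (k <= i)%N) recip (p i).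

Definition k0 (R : realType) (m : nat) (p : 'I_m -> \bar R) (r q : R) : nat :=
  \max_(t < m | r^-1 - q^-1 <= recip_tail p t) t.

Definition s_exp (R : realType) (m : nat) (p : 'I_m -> \bar R) (r q : R)
    (k : nat) : R :=
  if (k <= k0 p r q)%N then (r^-1 - recip_tail p k)^-1 else q.

(* Main.v *)
Require Import Defs.
From HB Require Import structures.
From mathcomp Require Import all_boot all_order all_algebra.
From mathcomp Require Import all_classical all_reals all_analysis.
From mathcomp Require Import complex.
From mathcomp Require Import ring lra.
Set Implicit Arguments.
Unset Strict Implicit.
Unset Printing Implicit Defensive.
Import Order.TTheory GRing.Theory Num.Theory.
Import numFieldNormedType.Exports.
Local Open Scope classical_set_scope.
Local Open Scope ring_scope.

(** Only two properties of [v] and [A] enter the argument, through the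
    multilinear map [G := v \o A] with values in [F].

    First, [G] is coordinatewise summing: when all arguments but the [i]-th are
    fixed in the unit balls and the [i]-th one runs over the [n] components of
    a vector of its ball, the values have [l_r] norm at most
    [L := pi_{r,1}(v) ||A||] ([summing_coordwise_summing]).  For a functional
    [phi] the sum of the [|phi (x_j)|] is the value of [phi] at a sum of the
    [x_j] with unimodular coefficients, and such coefficients can be absorbed
    in the argument of [A] without changing its [l_p] norm.

    Secondly, cotype combined with the equivalence of the [L_1] and [L_2] norms
    of Rademacher sums bounds an [l_q] sum in one coordinate by the average over
    signs of the values of [G] at sign vectors ([cotype_insert_at]).  Used in
    all coordinates but one ([iterated_cotype]) it gives an [l_r (l_q)]
    estimate, for every choice of the outer coordinate, for the coefficients of
    [G] multiplied by weights from the unit balls.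

    Everything else is about nonnegative arrays.  A family of weights in the
    ball of [l_p] can be removed at the cost of replacing the outer exponent
    [r] by [l] with [1/l = 1/r - 1/p]: by duality if the weights live on the
    outer coordinate ([lnorm_dual]), and by a double use of Hoelder's
    inequality if they live on an inner one and [l <= q] ([lnorm_swap_sum]).
    Removing the weights of the coordinates [2, .., m] keeps the outer exponent at
    most [q] precisely when the sum of their [1/p_i] is at most
    [1/r - 1/q]; this settles the case where only the outermost exponent
    differs from [q].

    The other case is an induction on [m] ([coordwise_summing_mixed_norm]).
    All exponents of the inner mixed norm are then at least [q], so an outer sum
    with the largest of them can be moved inside and turned into an [l_q] sum
    ([lnorm_mixed_norm_le]).  Cotype replaces that sum by an average over sign
    vectors in the first argument, where the induction hypothesis applies, and
    duality in the first coordinate produces the last exponent.  Each coordinate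
    but one costs a factor [sqrt 2 * max c 0]. *)

(** * Hoelder's inequality, finite [l_s] norms and weights *)

Lemma powRK (R : realType) (x s : R) : 0 <= x -> s != 0 ->
  (x `^ s) `^ s^-1 = x.
Proof. by move=> x0 s0; rewrite -powRrM mulfV// powRr1. Qed.

Lemma powRVK (R : realType) (x s : R) : 0 <= x -> s != 0 ->
  (x `^ s^-1) `^ s = x.
Proof. by move=> x0 s0; rewrite -powRrM mulVf// powRr1. Qed.

Lemma powR_split (R : realType) (x t : R) : 0 <= x ->
  x = x `^ t * x `^ (1 - t).
Proof.
by move=> x0; rewrite -powRD addrC subrK ?oner_eq0// powRr1.
Qed.

Lemma prod_powR (R : realType) (I : finType) (f : I -> R) (s : R) :
  (forall i, 0 <= f i) -> (\prod_i f i) `^ s = \prod_i f i `^ s.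
Proof.
move=> f0; elim: (index_enum I) => [|i e IH]; first by rewrite !big_nil powR1.
by rewrite !big_cons powRM ?prodr_ge0// IH.
Qed.

(** The form of Hoelder's inequality with exponents [1/t] and [1/(1 - t)], which
    keeps the endpoints [t = 0] and [t = 1]. *)
Lemma sum_powR_hoelder (R : realType) (I : finType) (P : pred I)
    (f g : I -> R) (t : R) :
  (forall i, 0 <= f i) -> (forall i, 0 <= g i) -> 0 <= t <= 1 ->
  \sum_(i | P i) f i `^ t * g i `^ (1 - t) <=
  (\sum_(i | P i) f i) `^ t * (\sum_(i | P i) g i) `^ (1 - t).
Proof.
move=> f0 g0 /andP[t0 t1].
have sf0 : 0 <= \sum_(i | P i) f i by apply: sumr_ge0.
have sg0 : 0 <= \sum_(i | P i) g i by apply: sumr_ge0.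
have [->|tn0] := eqVneq t 0.
  rewrite subr0 powRr0 mul1r powRr1//; apply: ler_sum => i _.
  by rewrite powRr0 mul1r powRr1.
have [->|tn1] := eqVneq t 1.
  rewrite subrr powRr0 mulr1 powRr1//; apply: ler_sum => i _.
  by rewrite powRr0 mulr1 powRr1.
have t_gt0 : 0 < t by rewrite lt0r tn0.
have t'_gt0 : 0 < 1 - t by rewrite subr_gt0 lt_neqAle tn1.
have [A0|An0] := eqVneq (\sum_(i | P i) f i) 0.
  rewrite big1 ?mulr_ge0 ?powR_ge0// => i Pi.
  have /eqP -> : f i == 0.
    by rewrite eq_le f0 andbT -A0 (bigD1 i)//= lerDl sumr_ge0.
  by rewrite powR0// mul0r.
have [B0|Bn0] := eqVneq (\sum_(i | P i) g i) 0.
  rewrite big1 ?mulr_ge0 ?powR_ge0// => i Pi.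
  have /eqP -> : g i == 0.
    by rewrite eq_le g0 andbT -B0 (bigD1 i)//= lerDl sumr_ge0.
  by rewrite (@powR0 _ (1 - t)) ?mulr0// gt_eqF.
set A := \sum_(i | P i) f i; set B := \sum_(i | P i) g i.
have le1 i : f i `^ t * g i `^ (1 - t) <=
    A `^ t * B `^ (1 - t) * (t * (f i / A) + (1 - t) * (g i / B)).
  have fA : 0 <= f i / A by rewrite divr_ge0.
  have gB : 0 <= g i / B by rewrite divr_ge0.
  have -> : f i `^ t * g i `^ (1 - t) =
      A `^ t * B `^ (1 - t) * ((f i / A) `^ t * (g i / B) `^ (1 - t)).
    rewrite mulrACA -!powRM// (mulrC A) (mulrC B) !divfK//.
  apply: ler_wpM2l; first by rewrite mulr_ge0 ?powR_ge0.
  have := @conjugate_powR R ((f i / A) `^ t) ((g i / B) `^ (1 - t)) t^-1 (1 - t)^-1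
     (powR_ge0 _ _) (powR_ge0 _ _).
  rewrite !invrK !powRK ?gt_eqF// !invr_gt0 => /(_ t_gt0 t'_gt0).
  by rewrite addrC subrK (mulrC t) (mulrC (1 - t)); exact.
apply: (le_trans (ler_sum _ (fun i _ => le1 i))).
rewrite -mulr_sumr big_split/= -!mulr_sumr -!mulr_suml.
by rewrite !mulfV// !mulr1 addrC subrK mulr1.
Qed.

Definition lnorm (R : realType) (I : finType) (s : R) (f : I -> R) : R :=
  (\sum_i f i `^ s) `^ s^-1.

Section lnorm_theory.
Variables (R : realType) (I : finType).
Implicit Types (f g : I -> R) (s t r L : R).

Lemma lnorm_ge0 s f : 0 <= lnorm s f. Proof. exact: powR_ge0. Qed.

Lemma sum_powR_ge0 s f : 0 <= \sum_i f i `^ s.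
Proof. by apply: sumr_ge0 => i _; exact: powR_ge0. Qed.
Hint Resolve sum_powR_ge0 : core.

Lemma lnormK s f : s != 0 -> lnorm s f `^ s = \sum_i f i `^ s.
Proof. by move=> s0; rewrite /lnorm powRVK. Qed.

Lemma eq_lnorm s f g : f =1 g -> lnorm s f = lnorm s g.
Proof. by move=> fg; rewrite /lnorm; under eq_bigr do rewrite fg. Qed.

Lemma le_lnorm s f g : 0 < s -> (forall i, 0 <= f i) ->
  (forall i, f i <= g i) -> lnorm s f <= lnorm s g.
Proof.
move=> s0 f0 fg; apply: ge0_ler_powR; rewrite ?nnegrE ?invr_ge0 ?(ltW s0)//.
apply: ler_sum => i _; apply: ge0_ler_powR; rewrite ?nnegrE ?(ltW s0)//.
exact: le_trans (fg i).
Qed.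

Lemma lnormZ s a f : 0 < s -> 0 <= a -> (forall i, 0 <= f i) ->
  lnorm s (fun i => a * f i) = a * lnorm s f.
Proof.
move=> s0 a0 f0; rewrite /lnorm; under eq_bigr do rewrite powRM//.
by rewrite -mulr_sumr powRM ?powR_ge0// powRK ?gt_eqF.
Qed.

Lemma lnorm_leP s f L : 0 < s -> 0 <= L ->
  (lnorm s f <= L) = (\sum_i f i `^ s <= L `^ s).
Proof.
move=> s0 L0; apply/idP/idP => h.
  rewrite -lnormK ?gt_eqF//; apply: ge0_ler_powR; rewrite ?nnegrE ?(ltW s0)//.
  exact: powR_ge0.
rewrite -[leRHS](@powRK _ _ s) ?gt_eqF//.
by apply: ge0_ler_powR; rewrite ?nnegrE ?powR_ge0 ?invr_ge0 ?(ltW s0).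
Qed.

Lemma le_coord_lnorm s f i : 0 < s -> 0 <= f i -> f i <= lnorm s f.
Proof.
move=> s0 fi0; rewrite -[leLHS](@powRK _ _ s) ?gt_eqF//.
apply: ge0_ler_powR; rewrite ?nnegrE ?invr_ge0 ?powR_ge0 ?(ltW s0)//.
by rewrite (bigD1 i)//= lerDl sumr_ge0// => j _; exact: powR_ge0.
Qed.

(** Every coordinate is at most the [l_s] norm, so the surplus power
    [f i ^ (t - s)] is at most the norm to that power. *)
Lemma lnorm_anti s t f : 0 < s -> s <= t -> (forall i, 0 <= f i) ->
  lnorm t f <= lnorm s f.
Proof.
move=> s0 st f0; have t0 : 0 < t := lt_le_trans s0 st.
rewrite lnorm_leP// ?lnorm_ge0//.
have split_powR x : 0 <= x -> x `^ t = x `^ s * x `^ (t - s).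
  move=> x0; rewrite -powRD ?(addrC s) ?subrK//.
  by rewrite gt_eqF.
rewrite [leRHS]split_powR ?lnorm_ge0// lnormK ?gt_eqF// mulr_suml.
apply: ler_sum => i _; rewrite split_powR//.
apply: ler_wpM2l; first exact: powR_ge0.
by apply: ge0_ler_powR; rewrite ?nnegrE ?lnorm_ge0 ?subr_ge0 ?le_coord_lnorm.
Qed.

(** Minkowski's inequality, by the usual route: with [h] the sum of the
    functions, write [h ^ s = h * h ^ (s - 1)], expand the first factor and apply
    Hoelder's inequality to each product. *)
Lemma lnorm_sum s (T : finType) (F : T -> I -> R) : 1 <= s ->
  (forall e i, 0 <= F e i) ->
  lnorm s (fun i => \sum_e F e i) <= \sum_e lnorm s (F e).
Proof.
move=> s1 F0; have s0 : 0 < s := lt_le_trans ltr01 s1.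
have [->|s_n1] := eqVneq s 1.
  rewrite /lnorm invr1 powRr1 ?sum_powR_ge0//.
  under eq_bigr do rewrite powRr1 ?sumr_ge0//.
  rewrite exchange_big; apply: ler_sum => e _ /=.
  rewrite powRr1 ?sum_powR_ge0//; apply: ler_sum => i _.
  by rewrite powRr1.
pose h i := \sum_e F e i.
have h0 i : 0 <= h i by apply: sumr_ge0.
set S := \sum_i h i `^ s.
have S0 : 0 <= S by exact: sum_powR_ge0.
have [Sz|Sn0] := eqVneq S 0.
  rewrite /lnorm -/S Sz powR0 ?invr_eq0 ?gt_eqF//.
  by apply: sumr_ge0 => e _; exact: lnorm_ge0.
have Spos : 0 < S by rewrite lt0r Sn0.
have sV : 0 <= s^-1 <= 1 by rewrite invr_ge0 ltW//= invf_le1.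
have bound : S <= (\sum_e lnorm s (F e)) * S `^ (1 - s^-1).
  rewrite {1}/S; under eq_bigr => i _.
    rewrite -mulr_powRB1// mulr_suml; over.
  rewrite exchange_big mulr_suml; apply: ler_sum => e _ /=.
  have := @sum_powR_hoelder R I xpredT (fun i => F e i `^ s) (fun i => h i `^ s)
    s^-1 (fun i => powR_ge0 _ _) (fun i => powR_ge0 _ _) sV.
  apply: le_trans; apply: ler_sum => i _.
  rewrite powRK ?gt_eqF// -powRrM mulrBr mulfV ?gt_eqF// mulr1//.
rewrite -(ler_pM2r (powR_gt0 (1 - s^-1) Spos)).
apply: le_trans bound; rewrite /lnorm -/S -powRD ?Sn0 ?implybT//.
by rewrite addrC subrK powRr1.
Qed.

End lnorm_theory.

Lemma lnorm1 (R : realType) (I : finType) (f : I -> R) :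
  (forall i, 0 <= f i) -> lnorm 1 f = \sum_i f i.
Proof.
move=> f0; rewrite /lnorm invr1 powRr1 ?sum_powR_ge0//.
by apply: eq_bigr => i _; rewrite powRr1.
Qed.

Lemma eq_lnorm_le (R : realType) (I : finType) (s L : R) (f g : I -> R) :
  f =1 g -> lnorm s g <= L -> lnorm s f <= L.
Proof. by move=> fg; rewrite (eq_lnorm s fg). Qed.

Lemma lnorm_powR (R : realType) (I : finType) (s t : R) (f : I -> R) :
  t != 0 -> lnorm s (fun i => f i `^ t) = lnorm (s * t) f `^ t.
Proof.
move=> t0; rewrite /lnorm.
have -> : \sum_i (f i `^ t) `^ s = \sum_i f i `^ (s * t).
  by apply: eq_bigr => i _; rewrite -powRrM mulrC.
set S := \sum_i _.
by rewrite -[RHS]powRrM; congr (_ `^ _); rewrite invfM -mulrA mulVf// mulr1.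
Qed.

Lemma lnorm_swap (R : realType) (I J : finType) (s : R) (f : I -> J -> R) :
  0 < s -> lnorm s (fun i => lnorm s (f i)) = lnorm s (fun j => lnorm s (f^~ j)).
Proof.
move=> s0; rewrite {1}/lnorm [in RHS]/lnorm; congr (_ `^ _).
under eq_bigr do rewrite lnormK ?gt_eqF//.
under [RHS]eq_bigr do rewrite lnormK ?gt_eqF//.
exact: exchange_big.
Qed.

(** The weights [u i ^ tau] with [u] of sum at most one are the nonnegative
    vectors of the unit ball of [l_p], [p = 1 / tau]; writing them in this way
    covers [p = +oo], where they are constant.  The supremum in the converse of
    Hoelder's inequality is attained at [u i] proportional to [f i ^ l]. *)
Lemma lnorm_dual (R : realType) (I : finType) (r l tau L : R) (f : I -> R) :
  0 < r -> 0 < l -> l^-1 = r^-1 - tau -> 0 <= tau ->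
  (forall i, 0 <= f i) ->
  (forall u : I -> R, (forall i, 0 <= u i) -> \sum_i u i <= 1 ->
     lnorm r (fun i => u i `^ tau * f i) <= L) ->
  lnorm l f <= L.
Proof.
move=> r0 l0 lE tau0 f0 H.
set S := \sum_i f i `^ l.
have S0 : 0 <= S by apply: sumr_ge0 => i _; exact: powR_ge0.
have [Sz|Sn0] := eqVneq S 0.
  rewrite /lnorm -/S Sz powR0 ?invr_eq0 ?gt_eqF//.
  apply: le_trans (H (fun=> 0) _ _) => //; first exact: lnorm_ge0.
  by rewrite big1 ?ler01.
have Spos : 0 < S by rewrite lt0r Sn0.
have := H (fun i => f i `^ l / S); rewrite -mulr_suml -/S mulfV//.
have u0 i : 0 <= f i `^ l / S by rewrite divr_ge0 ?powR_ge0.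
move=> /(_ u0 (lexx _)); apply: le_trans; rewrite /lnorm -/S.
have rl : l * (r * tau) + r = l.
  have -> : tau = r^-1 - l^-1 by rewrite lE opprB addrCA subrr addr0.
  rewrite mulrBr mulfV ?gt_eqF// mulrBr mulr1 mulrCA mulfV ?gt_eqF// mulr1.
  by rewrite subrK.
have -> : \sum_i ((f i `^ l / S) `^ tau * f i) `^ r = S `^ (1 - r * tau).
  have pE i : ((f i `^ l / S) `^ tau * f i) `^ r =
      f i `^ l * S^-1 `^ (r * tau).
    rewrite powRM ?powR_ge0// -powRrM (mulrC tau) powRM ?powR_ge0 ?invr_ge0//.
    by rewrite mulrAC -powRrM -powRD ?rl// gt_eqF.
  under eq_bigr do rewrite pE.
  rewrite -mulr_suml -/S powRD ?Sn0 ?implybT// powRr1//; congr (_ * _).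
  by rewrite -powR_inv1// -powRrM mulN1r.
rewrite -powRrM; have -> // : (1 - r * tau) / r = l^-1.
by rewrite lE mulrBl mul1r mulrAC mulfV ?gt_eqF// mul1r.
Qed.

(** The weights sit on the inner coordinate here, so duality does not apply
    directly; the estimate with the roles of the coordinates exchanged makes up
    for this.  With [T i] the row sums, [T i ^ s] is the sum over [j] of
    [a i j * T i ^ (s - 1)].  Interpolating the factor [T i ^ (s - 1)] between
    [T i ^ (s' - 1)] and [1] bounds this by a product of powers of the column
    sums [X j] of [a i j * T i ^ (s' - 1)] and the plain column sums [Y j].
    The weighted hypothesis controls [X] by duality, the other one controls
    [Y], and a second use of Hoelder's inequality in [j] combines them.  This is
    an argument of Praciano-Pereira, normalized so that the inner exponent is
    one. *)
Lemma lnorm_swap_sum (R : realType) (I J : finType) (s' s kappa L : R)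
    (a : I -> J -> R) :
  0 < s' -> s' <= s -> s <= 1 -> s^-1 = s'^-1 - kappa ->
  (forall i j, 0 <= a i j) ->
  (forall u : J -> R, (forall j, 0 <= u j) -> \sum_j u j <= 1 ->
     lnorm s' (fun i => \sum_j u j `^ kappa * a i j) <= L) ->
  lnorm s (fun j => \sum_i a i j) <= L ->
  lnorm s (fun i => \sum_j a i j) <= L.
Proof.
move=> s'0 s's s1 sE a0 Hw Hcol.
have L0 : 0 <= L := le_trans (lnorm_ge0 _ _) Hcol.
have s0 : 0 < s := lt_le_trans s'0 s's.
have kE : kappa = s'^-1 - s^-1 by rewrite sE opprB addrCA subrr addr0.
(* If s' = s then kappa = 0 and all weights are 1, even for u = 0. *)
have [es|ns] := eqVneq s' s.
  have k0 : kappa = 0 by rewrite kE es subrr.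
  have := Hw (fun=> 0); rewrite big1 ?ler01// => /(_ (fun=> lexx _) isT).
  rewrite es k0; apply: le_trans; rewrite le_eqVlt; apply/orP; left.
  apply/eqP/eq_lnorm => i; apply: eq_bigr => j _.
  by rewrite powRr0 mul1r.
have s's' : s' < s by rewrite lt_neqAle ns.
have s'1 : s' < 1 := lt_le_trans s's' s1.
have s'1' : 0 < 1 - s' by rewrite subr_gt0.
pose T i := \sum_j a i j.
have T0 i : 0 <= T i by apply: sumr_ge0.
pose X j := \sum_i a i j * T i `^ (s' - 1).
pose Y j := \sum_i a i j.
have aT0 i j : 0 <= a i j * T i `^ (s' - 1) by rewrite mulr_ge0 ?powR_ge0.
have X0 j : 0 <= X j by apply: sumr_ge0.
have Y0 j : 0 <= Y j by apply: sumr_ge0.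
have ss'0 : 0 < s / s' by rewrite divr_gt0.
have HX : lnorm (s / s') X <= L `^ s'.
  apply: (@lnorm_dual _ _ 1 _ (kappa * s')) => //.
  - rewrite invf_div invr1 kE mulrBl mulVf ?gt_eqF//.
    by rewrite opprB addrCA subrr addr0 mulrC.
  - rewrite mulr_ge0 ?(ltW s'0)// kE subr_ge0 lef_pV2//.
  move=> u u0 u1.
  rewrite lnorm1; last by move=> j; rewrite mulr_ge0 ?powR_ge0.
  under eq_bigr do rewrite mulr_sumr.
  rewrite exchange_big/=.
  have := Hw u u0 u1; rewrite lnorm_leP//; apply: le_trans.
  apply: ler_sum => i _.
  under eq_bigr do rewrite mulrA.
  rewrite -mulr_suml.
  have le_row : \sum_j u j `^ (kappa * s') * a i j <=
      (\sum_j u j `^ kappa * a i j) `^ s' * T i `^ (1 - s').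
    have h0 j : 0 <= u j `^ kappa * a i j by rewrite mulr_ge0 ?powR_ge0.
    have s'01 : 0 <= s' <= 1 by rewrite (ltW s'0) ltW.
    apply: le_trans (sum_powR_hoelder xpredT h0 (a0 i) s'01).
    apply: ler_sum => j _; rewrite powRM ?powR_ge0// -powRrM -mulrA.
    by rewrite -powR_split.
  have [Tz|Tn0] := eqVneq (T i) 0.
    (* The left-hand side vanishes: 0 to the nonzero power s' - 1 is 0. *)
    by rewrite Tz (powR0 (_ : s' - 1 != 0)) ?mulr0 ?powR_ge0// subr_eq0 lt_eqF.
  apply: le_trans (ler_wpM2r (powR_ge0 _ _) le_row) _.
  rewrite -mulrA -powRD ?Tn0 ?implybT//.
  by rewrite (_ : 1 - s' + (s' - 1) = 0) ?powRr0 ?mulr1//; ring.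
pose t := (1 - s) / (1 - s').
have t01 : 0 <= t <= 1.
  rewrite /t divr_ge0 ?subr_ge0 ?(ltW s'1)//= ler_pdivrMr// mul1r lerD2l lerN2//.
pose phi := t * s' / s.
have phi01 : 0 <= phi <= 1.
  case/andP: t01 => t0 t1.
  have phi0 : 0 <= phi by apply: divr_ge0; [apply: mulr_ge0 => //|]; exact: ltW.
  rewrite phi0/= /phi ler_pdivrMr// mul1r.
  by rewrite (le_trans _ s's)// ler_piMl// ltW.
have col j : \sum_i a i j * T i `^ (s - 1) <=
    (X j `^ (s / s')) `^ phi * (Y j `^ s) `^ (1 - phi).
  have -> : (X j `^ (s / s')) `^ phi = X j `^ t.
    rewrite -powRrM /phi; congr (_ `^ _).
    by field; rewrite !gt_eqF.
  have -> : (Y j `^ s) `^ (1 - phi) = Y j `^ (1 - t).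
    rewrite -powRrM /phi; congr (_ `^ _).
    have lin (x y z : R) : x - y = 1 - z -> z - y = 1 - x.
      by move=> /eqP; rewrite subr_eq => /eqP ->; ring.
    have tE : t * (1 - s') = 1 - s by rewrite /t divfK// gt_eqF.
    rewrite mulrBr mulr1 (mulrC s) divfK ?gt_eqF//.
    by apply: lin; rewrite -tE mulrBr mulr1.
  apply: le_trans (sum_powR_hoelder xpredT (aT0^~ j) (a0^~ j) t01).
  apply: ler_sum => i _; rewrite powRM ?powR_ge0// mulrAC -powR_split//.
  rewrite -powRrM; have -> // : (s' - 1) * t = s - 1.
  by rewrite /t -(opprB 1 s') mulNr mulrCA mulfV ?gt_eqF// mulr1 opprB.
rewrite lnorm_leP ?sumr_ge0//.
have -> : \sum_i (\sum_j a i j) `^ s = \sum_j \sum_i a i j * T i `^ (s - 1).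
  rewrite exchange_big; apply: eq_bigr => i _ /=.
  by rewrite -mulr_suml -/(T i) mulr_powRB1.
apply: le_trans (ler_sum _ (fun j _ => col j)) _.
have := @sum_powR_hoelder R J xpredT (fun j => X j `^ (s / s')) (fun j => Y j `^ s)
  phi (fun j => powR_ge0 _ _) (fun j => powR_ge0 _ _) phi01.
move=> /le_trans; apply.
move: HX; rewrite lnorm_leP ?powR_ge0// -powRrM mulrCA mulfV ?gt_eqF// mulr1 => HX.
move: Hcol; rewrite lnorm_leP// => HY.
rewrite [leRHS](@powR_split _ _ phi) ?powR_ge0//.
case/andP: phi01 => phi0 phi1.
by apply: ler_pM; rewrite ?powR_ge0//; apply: ge0_ler_powR;
  rewrite ?nnegrE ?powR_ge0 ?sum_powR_ge0 ?subr_ge0.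
Qed.

(** * Inserting an argument, and averages over the discrete cube *)

(** Multilinear maps, arrays and sign patterns are all functions on ['I_m]; this
    is the operation by which they are treated one coordinate at a time. *)
Definition insert_at (T : Type) (m : nat) (k : 'I_m.+1) (x : T) (z : 'I_m -> T) :
  'I_m.+1 -> T := fun i => oapp z x (unlift k i).

Section insert_at_theory.
Variables (T : Type) (m : nat) (k : 'I_m.+1).
Implicit Types (x : T) (z : 'I_m -> T).

Lemma insert_at_eq x z : insert_at k x z k = x.
Proof. by rewrite /insert_at unlift_none. Qed.

Lemma insert_at_lift x z i : insert_at k x z (lift k i) = z i.
Proof. by rewrite /insert_at liftK. Qed.

Lemma insert_atK (z : 'I_m.+1 -> T) :
  insert_at k (z k) (fun i => z (lift k i)) = z.
Proof.
apply: funext => i; case: (unliftP k i) => [j|] ->.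
  by rewrite insert_at_lift.
by rewrite insert_at_eq.
Qed.

Lemma eq_insert_at x z z' : z =1 z' -> insert_at k x z = insert_at k x z'.
Proof. by move=> /funext ->. Qed.

Lemma dfwith_insert_at_eq x y z : dfwith (insert_at k x z) k y = insert_at k y z.
Proof.
apply: funext => i; case: (unliftP k i) => [j|] ->.
  by rewrite dfwithout ?insert_at_lift// neq_lift.
by rewrite dfwithin insert_at_eq.
Qed.

Lemma dfwith_insert_at_lift x y z i :
  dfwith (insert_at k x z) (lift k i) y = insert_at k x (dfwith z i y).
Proof.
apply: funext => l; case: (unliftP k l) => [j|] ->; last first.
  by rewrite insert_at_eq dfwithout ?insert_at_eq// eq_sym neq_lift.
rewrite insert_at_lift; have [->|ij] := eqVneq j i; first by rewrite !dfwithin.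
by rewrite !dfwithout ?insert_at_lift ?(inj_eq lift_inj) 1?eq_sym.
Qed.

End insert_at_theory.

Lemma sum_insert_at (V : nmodType) (T : finType) (m : nat) (k : 'I_m.+1)
    (P : pred T) (h : ('I_m.+1 -> T) -> V) :
  \sum_(J : {ffun 'I_m.+1 -> T} | P (J k)) h J =
  \sum_(x | P x) \sum_(J : {ffun 'I_m -> T}) h (insert_at k x J).
Proof.
rewrite pair_big_dep/=.
rewrite (reindex (fun p : T * {ffun 'I_m -> T} =>
  [ffun i => insert_at k p.1 p.2 i]))/=; last first.
  exists (fun J : {ffun 'I_m.+1 -> T} => (J k, [ffun i => J (lift k i)])).
    move=> [x J] _; rewrite ffunE insert_at_eq/=; congr (_, _).
    by apply/ffunP => i; rewrite !ffunE insert_at_lift.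
  move=> J _; apply/ffunP => i; rewrite ffunE/=.
  rewrite (@eq_insert_at _ _ _ _ _ (fun i => J (lift k i))) ?insert_atK// => j.
  by rewrite ffunE.
apply: eq_big => [[x J]|[x J] _]; first by rewrite ffunE insert_at_eq/= andbT.
by congr (h _); apply: funext => i; rewrite ffunE.
Qed.

Section cube.
Variable R : realType.

Definition cube_avg (n : nat) (f : ('I_n -> bool) -> R) : R :=
  (2 ^+ n)^-1 * \sum_(e : {ffun 'I_n -> bool}) f e.

Definition flip (n : nat) (i : 'I_n) (e : 'I_n -> bool) : 'I_n -> bool :=
  fun j => (i == j) (+) e j.

(** Four times the Dirichlet form of the discrete cube: the Walsh function of a
    set [S] has energy [4 * #|S|]. *)
Definition cube_energy (n : nat) (f : ('I_n -> bool) -> R) : R :=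
  \sum_i cube_avg (fun e => (f e - f (flip i e)) ^+ 2).

Lemma eq_cube_avg n (f g : ('I_n -> bool) -> R) : f =1 g ->
  cube_avg f = cube_avg g.
Proof. by move=> fg; congr (_ * _); apply: eq_bigr => e _; exact: fg. Qed.

Lemma le_cube_avg n (f g : ('I_n -> bool) -> R) : (forall e, f e <= g e) ->
  cube_avg f <= cube_avg g.
Proof.
move=> fg; apply: ler_wpM2l; first by rewrite invr_ge0 exprn_ge0.
exact: ler_sum.
Qed.

Lemma cube_avg_cst n (c : R) : cube_avg (fun _ : 'I_n -> bool => c) = c.
Proof.
rewrite /cube_avg sumr_const card_ffun card_bool card_ord -[X in _ * X]mulr_natr natrX.
by rewrite mulrCA mulVf ?mulr1// expf_neq0// pnatr_eq0.
Qed.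

Lemma cube_avg_ge0 n (f : ('I_n -> bool) -> R) : (forall e, 0 <= f e) ->
  0 <= cube_avg f.
Proof. by move=> f0; rewrite -(cube_avg_cst n 0) le_cube_avg. Qed.

Lemma cube_avgD n (f g : ('I_n -> bool) -> R) :
  cube_avg (fun e => f e + g e) = cube_avg f + cube_avg g.
Proof. by rewrite /cube_avg big_split mulrDr. Qed.

Lemma cube_avgZ n a (f : ('I_n -> bool) -> R) :
  cube_avg (fun e => a * f e) = a * cube_avg f.
Proof. by rewrite /cube_avg -mulr_sumr mulrCA. Qed.

Lemma cube_avgB n (f g : ('I_n -> bool) -> R) :
  cube_avg (fun e => f e - g e) = cube_avg f - cube_avg g.
Proof. by rewrite /cube_avg sumrB mulrBr. Qed.

Lemma cube_avg_sum n (I : finType) (f : I -> ('I_n -> bool) -> R) :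
  cube_avg (fun e => \sum_i f i e) = \sum_i cube_avg (f i).
Proof. by rewrite /cube_avg exchange_big/= mulr_sumr. Qed.

Lemma cube_avgS n (f : ('I_n.+1 -> bool) -> R) :
  cube_avg f = (cube_avg (fun e => f (insert_at ord0 false e)) +
                cube_avg (fun e => f (insert_at ord0 true e))) / 2.
Proof.
rewrite /cube_avg (@sum_insert_at _ _ _ ord0 xpredT) big_bool/= -mulrDr addrC.
by rewrite mulrAC exprSr invfM.
Qed.

Lemma cube_avg_reindex n (s : ('I_n -> bool) -> ('I_n -> bool))
    (f : ('I_n -> bool) -> R) :
  involutive s -> cube_avg (fun e => f (s e)) = cube_avg f.
Proof.
move=> sK; rewrite /cube_avg; congr (_ * _).
rewrite [RHS](reindex_inj (h := fun e : {ffun 'I_n -> bool} => [ffun i => s e i])).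
  by apply: eq_bigr => e _; congr f; apply: funext => i; rewrite ffunE.
apply: (can_inj (g := fun e : {ffun 'I_n -> bool} => [ffun i => s e i])) => e.
apply/ffunP => i; rewrite ffunE.
have -> : fun_of_fin [ffun j => s e j] = s e by apply: funext => j; rewrite ffunE.
by rewrite sK.
Qed.

Lemma flipK n (i : 'I_n) : involutive (flip i).
Proof.
by move=> e; apply: funext => j; rewrite /flip; case: (i == j); case: (e j).
Qed.

Lemma flip_insert0 n b (e : 'I_n -> bool) :
  flip ord0 (insert_at ord0 b e) = insert_at ord0 (~~ b) e.
Proof.
apply: funext => j; rewrite /flip; case: (unliftP ord0 j) => [l|] ->.
  by rewrite !insert_at_lift (negbTE (neq_lift _ _)).
by rewrite !insert_at_eq eqxx.
Qed.

Lemma flip_insert_lift n b (i : 'I_n) (e : 'I_n -> bool) :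
  flip (lift ord0 i) (insert_at ord0 b e) = insert_at ord0 b (flip i e).
Proof.
apply: funext => j; rewrite /flip; case: (unliftP ord0 j) => [l|] ->.
  by rewrite !insert_at_lift (inj_eq lift_inj).
by rewrite !insert_at_eq eq_sym (negbTE (neq_lift _ _)).
Qed.

Lemma cube_energyS n (f : ('I_n.+1 -> bool) -> R) :
  let f0 e := f (insert_at ord0 false e) in
  let f1 e := f (insert_at ord0 true e) in
  cube_energy f = cube_avg (fun e => (f0 e - f1 e) ^+ 2) +
                  (cube_energy f0 + cube_energy f1) / 2.
Proof.
move=> f0 f1; rewrite /cube_energy big_ord_recl cube_avgS; congr (_ + _).
  under [in X in _ + X]eq_cube_avg do rewrite flip_insert0 -sqrrN opprB.
  under eq_cube_avg do rewrite flip_insert0.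
  rewrite -[RHS](@mulfK _ 2)// ?pnatr_eq0//; congr (_ / _).
  by rewrite mulr2n mulrDr mulr1.
rewrite -big_split/= mulr_suml; apply: eq_bigr => i _.
rewrite cube_avgS.
under eq_cube_avg do rewrite flip_insert_lift.
by under [in X in _ + X]eq_cube_avg do rewrite flip_insert_lift.
Qed.

Lemma sqr_cube_avg_le n (f : ('I_n -> bool) -> R) :
  cube_avg f ^+ 2 <= cube_avg (fun e => f e ^+ 2).
Proof.
rewrite -subr_ge0; set a := cube_avg f.
have -> : cube_avg (fun e => f e ^+ 2) - a ^+ 2 = cube_avg (fun e => (f e - a) ^+ 2).
  under [RHS]eq_cube_avg => e.
    rewrite (_ : _ ^+ 2 = f e ^+ 2 + ((- 2 * a) * f e + a ^+ 2)); last by ring.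
    over.
  by rewrite !cube_avgD cube_avgZ cube_avg_cst -/a; ring.
by apply: cube_avg_ge0 => e; exact: sqr_ge0.
Qed.

(** The spectral gap of the cube. In the induction the cube splits into two faces,
    and the square of the difference of their averages is bounded by the average
    of the squared difference, which is the energy in the new direction. *)
Lemma cube_poincare n (f : ('I_n -> bool) -> R) :
  4 * (cube_avg (fun e => f e ^+ 2) - cube_avg f ^+ 2) <= cube_energy f.
Proof.
elim: n f => [|n IH] f.
  rewrite /cube_energy big_ord0.
  pose c := f (fun=> false).
  have fc e : f e = c by congr f; apply: funext => -[].
  rewrite (eq_cube_avg fc) cube_avg_cst.
  under eq_cube_avg do rewrite fc.
  by rewrite cube_avg_cst subrr mulr0.
rewrite cube_energyS !cube_avgS.
set f0 := fun e => f (insert_at ord0 false e).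
set f1 := fun e => f (insert_at ord0 true e).
have := IH f0; have := IH f1.
have := sqr_cube_avg_le (fun e => f0 e - f1 e).
rewrite cube_avgB => h0 h1 h2.
rewrite /f0 /f1 in h0 h1 h2 *.
nra.
Qed.

(** A Walsh coefficient of level [n] enters the energy with the factor [4 * n],
    which is at least [8] except on the levels zero and one; the last two terms
    restore these.  The induction writes [f = g + chi * h] with [chi] the
    new sign, so that [g] falls under the induction hypothesis and [h] under
    [cube_poincare]. *)
Lemma cube_poincare2 n (f : ('I_n -> bool) -> R) :
  8 * cube_avg (fun e => f e ^+ 2) <=
  cube_energy f + 8 * cube_avg f ^+ 2 +
  4 * \sum_i cube_avg (fun e => (-1) ^+ e i * f e) ^+ 2.
Proof.
elim: n f => [|n IH] f.
  rewrite /cube_energy !big_ord0 mulr0 addr0 add0r.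
  pose c := f (fun=> false).
  have fc e : f e = c by congr f; apply: funext => -[].
  rewrite (eq_cube_avg fc) cube_avg_cst.
  under eq_cube_avg do rewrite fc.
  by rewrite cube_avg_cst.
pose f0 e := f (insert_at ord0 false e).
pose f1 e := f (insert_at ord0 true e).
pose g e := (f0 e + f1 e) / 2.
pose h e := (f0 e - f1 e) / 2.
have Ef : cube_avg f = cube_avg g.
  rewrite cube_avgS -cube_avgD mulrC -cube_avgZ.
  by apply: eq_cube_avg => e; rewrite /g mulrC.
have Ef2 : cube_avg (fun e => f e ^+ 2) =
    cube_avg (fun e => g e ^+ 2) + cube_avg (fun e => h e ^+ 2).
  rewrite cube_avgS -!cube_avgD mulrC -cube_avgZ.
  by apply: eq_cube_avg => e; rewrite -/(f0 e) -/(f1 e) /g /h; field.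
have en : cube_energy f =
    4 * cube_avg (fun e => h e ^+ 2) + cube_energy g + cube_energy h.
  rewrite cube_energyS -/f0 -/f1 -addrA; congr (_ + _).
    by rewrite -cube_avgZ; apply: eq_cube_avg => e; rewrite /= -/(f0 e) -/(f1 e) /h; field.
  rewrite /cube_energy -!big_split/= mulr_suml; apply: eq_bigr => i _.
  rewrite -!cube_avgD mulrC -cube_avgZ.
  by apply: eq_cube_avg => e; rewrite /g /h; field.
have four : \sum_i cube_avg (fun e => (-1) ^+ e i * f e) ^+ 2 =
    cube_avg h ^+ 2 + \sum_i cube_avg (fun e => (-1) ^+ e i * g e) ^+ 2.
  rewrite big_ord_recl; congr (_ + _).
    rewrite cube_avgS -cube_avgD mulrC -cube_avgZ; congr (_ ^+ 2).
    apply: eq_cube_avg => e; rewrite !insert_at_eq -/(f0 e) -/(f1 e) /h.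
    by rewrite expr0 expr1; field.
  apply: eq_bigr => i _; rewrite cube_avgS -cube_avgD mulrC -cube_avgZ.
  congr (_ ^+ 2); apply: eq_cube_avg => e.
  by rewrite !insert_at_lift -/(f0 e) -/(f1 e) /g; field.
have := IH g; have := cube_poincare h.
rewrite Ef Ef2 en four; lra.
Qed.

(** An even function has no Walsh coefficients on level one, which doubles the
    spectral gap. *)
Lemma cube_poincare_even n (f : ('I_n -> bool) -> R) :
  (forall e, f (fun i => ~~ e i) = f e) ->
  8 * (cube_avg (fun e => f e ^+ 2) - cube_avg f ^+ 2) <= cube_energy f.
Proof.
move=> feven.
have odd0 i : cube_avg (fun e => (-1) ^+ e i * f e) = 0.
  have negK : involutive (fun (e : 'I_n -> bool) j => ~~ e j).
    by move=> e; apply: funext => j; rewrite negbK.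
  have := cube_avg_reindex (fun e => (-1) ^+ e i * f e) negK.
  under eq_cube_avg => e.
    rewrite feven (_ : (-1) ^+ (~~ e i) * f e = (-1) * ((-1) ^+ e i * f e)).
      over.
    by case: (e i); rewrite ?expr0 ?expr1; ring.
  rewrite cube_avgZ; lra.
have := cube_poincare2 f.
rewrite big1; first by rewrite mulr0 mulrBr; lra.
by move=> i _; rewrite odd0 expr0n.
Qed.

End cube.

Lemma lnorm_cube_avg (R : realType) (I : finType) (n : nat) (s : R)
    (f : ('I_n -> bool) -> I -> R) :
  1 <= s -> (forall e i, 0 <= f e i) ->
  lnorm s (fun i => cube_avg (fun e => f e i)) <= cube_avg (fun e => lnorm s (f e)).
Proof.
move=> s1 f0; rewrite /cube_avg lnormZ ?invr_ge0 ?exprn_ge0//; first last.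
- by move=> i; apply: sumr_ge0.
- exact: lt_le_trans s1.
apply: ler_wpM2l; first by rewrite invr_ge0 exprn_ge0.
exact: (@lnorm_sum _ _ _ _ (fun (e : {ffun 'I_n -> bool}) i => f e i)).
Qed.

Lemma lnorm_insert_at (R : realType) (T : finType) (m : nat) (k : 'I_m.+1) (s : R)
    (h : ('I_m.+1 -> T) -> R) : 0 < s ->
  lnorm s (fun J : {ffun 'I_m.+1 -> T} => h J) =
  lnorm s (fun x => lnorm s (fun J : {ffun 'I_m -> T} => h (insert_at k x J))).
Proof.
move=> s0; rewrite /lnorm; congr (_ `^ _).
rewrite (@sum_insert_at _ _ _ k xpredT (fun J => h J `^ s)).
by apply: eq_bigr => x _; rewrite powRVK ?gt_eqF ?sum_powR_ge0.
Qed.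

Lemma lnorm_ffun0 (R : realType) (T : finType) (s : R) (h : ('I_0 -> T) -> R) z :
  0 < s -> (forall z, 0 <= h z) ->
  lnorm s (fun J : {ffun 'I_0 -> T} => h J) = h z.
Proof.
move=> s0 h0; rewrite /lnorm.
have hE (J : {ffun 'I_0 -> T}) : h J = h z by congr h; apply: funext => -[].
under eq_bigr do rewrite hE.
by rewrite sumr_const card_ffun card_ord expn0 mulr1n powRK ?gt_eqF.
Qed.

(** * Real-valued norms over both scalar fields, and Rademacher sums *)

(** The scalar field is an opaque [numFieldType] until the case analysis on [k];
    this embedding of the reals is its common interface. *)
Definition scal (R : realType) (k : RorC) : R -> scalars R k :=
  match k return R -> scalars R k with
  | RealScalars => id
  | ComplexScalars => fun x : R => (x%:C)%C
  end.

Arguments scal {R} k x : rename.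

Section rnorm_theory.
Variables (R : realType) (k : RorC).
Implicit Types (a b : R) (V : normedModType (scalars R k)).

Lemma norm_rnorm V (x : V) : `|x| = scal k (rnorm x).
Proof.
rewrite /rnorm; case: k V x => V x //=.
have : 0 <= `|x| by apply: normr_ge0.
by case: `|x| => a b; rewrite lecE/= => /andP[/eqP -> _].
Qed.

Lemma scalD a b : scal k (a + b) = scal k a + scal k b.
Proof. by case: k => //=; rewrite rmorphD. Qed.

Lemma scalM a b : scal k (a * b) = scal k a * scal k b.
Proof. by case: k => //=; rewrite rmorphM. Qed.

Lemma scal0 : scal k (0 : R) = 0. Proof. by case: k => //=; rewrite rmorph0. Qed.

Lemma scal1 : scal k (1 : R) = 1. Proof. by case: k => //=; rewrite rmorph1. Qed.

Lemma scalN1X (n : nat) : scal k ((-1) ^+ n : R) = (-1) ^+ n.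
Proof. by case: k => //=; rewrite rmorphXn rmorphN rmorph1. Qed.

Lemma scal_inj : injective (@scal R k).
Proof. by case: k => //= a b []. Qed.

Lemma ler_scal a b : (scal k a <= scal k b) = (a <= b).
Proof. by case: k => //=; rewrite lecR. Qed.

Lemma norm_scal a : `|scal k a| = scal k `|a|.
Proof. by case: k => //=; rewrite normc_def/= expr0n addr0 sqrtr_sqr. Qed.

Lemma rnorm_ge0 V (x : V) : 0 <= rnorm x.
Proof. by rewrite -ler_scal -norm_rnorm scal0 normr_ge0. Qed.

Lemma rnormD V (x y : V) : rnorm (x + y) <= rnorm x + rnorm y.
Proof. by rewrite -ler_scal scalD -!norm_rnorm ler_normD. Qed.

Lemma rnormN V (x : V) : rnorm (- x) = rnorm x.
Proof. by apply: scal_inj; rewrite -!norm_rnorm normrN. Qed.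

Lemma rnorm0 V : rnorm (0 : V) = 0.
Proof. by apply: scal_inj; rewrite -norm_rnorm normr0 scal0. Qed.

Lemma rnormZ V (c : scalars R k) (x : V) :
  rnorm (c *: x) = rnorm (c : (scalars R k)^o) * rnorm x.
Proof. by apply: scal_inj; rewrite scalM -!norm_rnorm normrZ. Qed.

Lemma rnorm_scal a : rnorm (scal k a : (scalars R k)^o) = `|a|.
Proof. by apply: scal_inj; rewrite -norm_rnorm norm_scal. Qed.

Lemma rnorm_scalZ V a (x : V) : 0 <= a -> rnorm (scal k a *: x) = a * rnorm x.
Proof. by move=> a0; rewrite rnormZ rnorm_scal ger0_norm. Qed.

Lemma rnormMn V (x : V) n : rnorm (x *+ n) = n%:R * rnorm x.
Proof.
elim: n => [|n IH]; first by rewrite mulr0n rnorm0 mul0r.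
have -> : x *+ n.+1 = scal k n.+1%:R *: x.
  elim: {IH} n => [|n IH]; first by rewrite scal1 scale1r.
  by rewrite -natr1 scalD scalerDl -IH scal1 scale1r mulrSr.
by rewrite rnorm_scalZ.
Qed.

Lemma rnorm_sum V (I : finType) (F : I -> V) :
  rnorm (\sum_i F i) <= \sum_i rnorm (F i).
Proof.
elim/big_ind2: _ => [|x a y b xa yb|//]; first by rewrite rnorm0.
exact: le_trans (rnormD _ _) (lerD xa yb).
Qed.

Lemma rnorm_sign (b : bool) : rnorm ((-1) ^+ b : (scalars R k)^o) = 1.
Proof.
rewrite -scalN1X rnorm_scal.
by case: b; rewrite ?expr0 ?expr1 ?normrN normr1.
Qed.

Lemma phaseP (z : scalars R k) :
  exists2 t : scalars R k, rnorm (t : (scalars R k)^o) = 1 &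
    t * z = scal k (rnorm (z : (scalars R k)^o)).
Proof.
have [->|zn0] := eqVneq z 0.
  exists 1; first by rewrite -scal1 rnorm_scal normr1.
  by rewrite mulr0 rnorm0 scal0.
exists (`|z| / z).
  apply: scal_inj; rewrite -norm_rnorm scal1 normrM normr_id.
  by rewrite normfV mulfV// normr_eq0.
by rewrite divfK// norm_rnorm.
Qed.

End rnorm_theory.

Section kahane.
Variables (R : realType) (k : RorC) (F : normedModType (scalars R k)).
Variables (n : nat) (x : 'I_n -> F).

Definition rademacher_sum (e : 'I_n -> bool) : F := \sum_j (-1) ^+ e j *: x j.

(** Flipping the [i]-th sign subtracts twice the [i]-th term, so the sum over all
    flips misses twice the whole sum. *)
Lemma sum_rademacher_flip (e : 'I_n -> bool) :
  \sum_i rademacher_sum (flip i e) + rademacher_sum e *+ 2 =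
  rademacher_sum e *+ n.
Proof.
have E i : rademacher_sum (flip i e) =
    rademacher_sum e - ((-1) ^+ e i *: x i) *+ 2.
  rewrite /rademacher_sum (bigD1 i)//= [X in _ = X - _](bigD1 i)//=.
  rewrite /flip eqxx addTb addrAC mulr2n opprD addrA subrr sub0r.
  congr (_ + _); first by case: (e i); rewrite ?expr0 ?expr1 ?scaleN1r ?scale1r ?opprK.
  by apply: eq_bigr => j ji; rewrite eq_sym (negbTE ji).
under eq_bigr do rewrite E.
rewrite sumrB sumr_const card_ord sumrMnl -/(rademacher_sum e).
by rewrite subrK.
Qed.

(** By the triangle inequality and [sum_rademacher_flip], the norm [f] of a
    Rademacher sum satisfies [n f - \sum_i f \o flip i <= 2 f]; multiply by [f]
    and average. *)
Lemma rademacher_energy_le :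
  cube_energy (fun e => rnorm (rademacher_sum e)) <=
  4 * cube_avg (fun e => rnorm (rademacher_sum e) ^+ 2).
Proof.
set f := fun e => rnorm (rademacher_sum e).
have E i : cube_avg (fun e => (f e - f (flip i e)) ^+ 2) =
    cube_avg (fun e => 2 * (f e ^+ 2 - f e * f (flip i e))).
  rewrite cube_avgZ cube_avgB.
  under eq_cube_avg => e.
    rewrite (_ : _ ^+ 2 = f e ^+ 2 + f (flip i e) ^+ 2 + (- 2) * (f e * f (flip i e)));
      last by ring.
    over.
  rewrite !cube_avgD cube_avgZ.
  by rewrite (cube_avg_reindex (fun e => f e ^+ 2) (@flipK _ i)); ring.
rewrite /cube_energy; under eq_bigr do rewrite E.
rewrite -cube_avg_sum -cube_avgZ; apply: le_cube_avg => e.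
have f0 : 0 <= f e by exact: rnorm_ge0.
have key : n%:R * f e <= \sum_i f (flip i e) + 2 * f e.
  rewrite -rnormMn -sum_rademacher_flip.
  apply: (le_trans (rnormD _ _)); rewrite rnormMn lerD2r.
  exact: rnorm_sum.
rewrite -mulr_sumr sumrB sumr_const card_ord -mulr_sumr -mulr_natr.
rewrite expr2; nra.
Qed.

(** Kahane's inequality between [L_2] and [L_1] with the constant [sqrt 2], by the
    argument of Latala and Oleszkiewicz: the norm of a Rademacher sum is an even
    function on the cube, and comparing the doubled spectral gap with
    [rademacher_energy_le] bounds its variance by half of its second moment. *)
Lemma rademacher_L2_le :
  rademacher_L2 x <= Num.sqrt 2 * cube_avg (fun e => rnorm (rademacher_sum e)).
Proof.
set f := fun e => rnorm (rademacher_sum e).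
have even e : f (fun i => ~~ e i) = f e.
  rewrite /f -rnormN; congr rnorm; rewrite /rademacher_sum -sumrN.
  apply: eq_bigr => j _; rewrite -scaleNr.
  by case: (e j); rewrite ?expr0 ?expr1 ?opprK.
have f0 : 0 <= cube_avg f by apply: cube_avg_ge0 => e; exact: rnorm_ge0.
have := le_trans (cube_poincare_even even) rademacher_energy_le.
rewrite -/f => h.
have {}h : cube_avg (fun e => f e ^+ 2) <= 2 * cube_avg f ^+ 2 by lra.
rewrite -[X in _ * X](ger0_norm f0) -sqrtr_sqr -sqrtrM//.
exact: ler_wsqrtr.
Qed.

(** The maximum with zero gives a nonnegative constant, since a cotype constant
    may be negative when the space is trivial. *)
Lemma cotype_L1 (q c : R) : cotype_with q c F ->
  lnorm q (fun j => rnorm (x j)) <=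
  (Num.sqrt 2 * Num.max c 0) * cube_avg (fun e => rnorm (rademacher_sum e)).
Proof.
move=> /(_ _ x) /le_trans; apply.
rewrite mulrAC [leRHS]mulrC.
apply: (@le_trans _ _ (Num.max c 0 * rademacher_L2 x)).
  by rewrite ler_wpM2r ?sqrtr_ge0// le_max lexx.
rewrite ler_wpM2l ?le_max ?lexx ?orbT//.
exact: rademacher_L2_le.
Qed.

End kahane.

(** * Mixed norms *)

Section mixed_norm_theory.
Variables (R : realType) (n : nat).
Implicit Types (s : nat -> R).

Lemma mixed_normS m s (f : m.+1.-tuple 'I_n -> R) :
  mixed_norm s f = lnorm (s 0%N)
    (fun j => mixed_norm (fun k => s k.+1) (fun t => f [tuple of j :: t])).
Proof. by []. Qed.

Lemma mixed_norm_ge0 m s (f : m.-tuple 'I_n -> R) :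
  (forall t, 0 <= f t) -> 0 <= mixed_norm s f.
Proof. by case: m f => [|m] f f0 /=; [exact: f0|exact: powR_ge0]. Qed.

Lemma eq_mixed_norm m s s' (f f' : m.-tuple 'I_n -> R) :
  (forall k, (k < m)%N -> s k = s' k) -> f =1 f' ->
  mixed_norm s f = mixed_norm s' f'.
Proof.
elim: m s s' f f' => [|m IH] s s' f f' ss ff; first exact: ff.
rewrite (mixed_normS s) (mixed_normS s') (ss 0%N isT); apply: eq_lnorm => j.
by apply: IH => [k km|t]; [exact: ss|exact: ff].
Qed.

Lemma le_mixed_norm m s (f g : m.-tuple 'I_n -> R) :
  (forall k, (k < m)%N -> 0 < s k) -> (forall t, 0 <= f t) ->
  (forall t, f t <= g t) -> mixed_norm s f <= mixed_norm s g.
Proof.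
elim: m s f g => [|m IH] s f g s0 f0 fg; first exact: fg.
rewrite (mixed_normS s f) (mixed_normS s g); apply: le_lnorm => [|j|j]; first exact: s0.
  by apply: mixed_norm_ge0 => t.
by apply: IH => // k km; exact: s0.
Qed.

Lemma mixed_normZ m s a (f : m.-tuple 'I_n -> R) :
  (forall k, (k < m)%N -> 0 < s k) -> 0 <= a -> (forall t, 0 <= f t) ->
  mixed_norm s (fun t => a * f t) = a * mixed_norm s f.
Proof.
elim: m s f => [|m IH] s f s0 a0 f0 //.
rewrite (mixed_normS s f) (mixed_normS s) -(lnormZ (s0 0%N isT) a0).
  by apply: eq_lnorm => j; apply: IH => // k km; exact: s0.
by move=> j; exact: mixed_norm_ge0.
Qed.

Lemma mixed_norm_cube_avg m N s (f : ('I_N -> bool) -> m.-tuple 'I_n -> R) :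
  (forall k, (k < m)%N -> 1 <= s k) -> (forall e t, 0 <= f e t) ->
  mixed_norm s (fun t => cube_avg (fun e => f e t)) <=
  cube_avg (fun e => mixed_norm s (f e)).
Proof.
elim: m s f => [|m IH] s f s1 f0; first by [].
rewrite (mixed_normS s).
have s0 : 1 <= s 0%N by exact: s1.
apply: le_trans (@lnorm_cube_avg _ _ _ _ (fun e j => mixed_norm (fun k => s k.+1)
   (fun t => f e [tuple of j :: t])) s0 _).
  apply: le_lnorm => [|j|j]; first exact: lt_le_trans s0.
    by apply: mixed_norm_ge0 => t; exact: cube_avg_ge0.
  by apply: (IH _ (fun e t => f e [tuple of j :: t])) => // k km; exact: s1.
by move=> e j; exact: mixed_norm_ge0.
Qed.

(** Minkowski's inequality would move the outer sum inside at the exponent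
    [sigma]; lowering that exponent to the current one before each exchange
    makes the exchange an equality. The monotonicity of the exponents is what
    makes this possible at every level. *)
Lemma lnorm_mixed_norm_le m (T : finType) q sigma s (f : T -> m.-tuple 'I_n -> R) :
  0 < q -> q <= sigma ->
  (forall k, (k < m)%N -> q <= s k <= sigma) ->
  (forall k l, (k <= l < m)%N -> s l <= s k) ->
  (forall i t, 0 <= f i t) ->
  lnorm sigma (fun i => mixed_norm s (f i)) <=
  mixed_norm s (fun t => lnorm q (fun i => f i t)).
Proof.
move=> q0; elim: m sigma s f => [|m IH] sigma s f qs hs mono f0.
  by apply: lnorm_anti => // i; exact: f0.
have /andP[qs0 s0s] := hs 0%N isT.
have s00 : 0 < s 0%N := lt_le_trans q0 qs0.
apply: le_trans (@lnorm_anti _ _ (s 0%N) _ _ s00 s0s _) _.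
  by move=> i; exact: mixed_norm_ge0.
rewrite (mixed_normS s) (lnorm_swap (fun i j => mixed_norm (fun k => s k.+1)
  (fun t => f i [tuple of j :: t])) s00).
apply: le_lnorm => // j; first exact: lnorm_ge0.
apply: (IH _ _ (fun i t => f i [tuple of j :: t])) => //.
- by move=> k km; have /andP[-> _] := hs k.+1 km; exact: mono.
- by move=> k l kl; exact: mono.
Qed.

Lemma mixed_norm_cst m q (h : ('I_m -> 'I_n) -> R) :
  0 < q -> (forall z, 0 <= h z) ->
  mixed_norm (fun=> q) (fun t => h (tnth t)) =
  lnorm q (fun J : {ffun 'I_m -> 'I_n} => h J).
Proof.
move=> q0; elim: m h => [|m IH] h h0.
  by rewrite (lnorm_ffun0 (tnth [tuple])).
rewrite (mixed_normS (fun=> q)) (lnorm_insert_at ord0 h q0).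
apply: eq_lnorm => j.
rewrite -(IH (fun z => h (insert_at ord0 j z)) (fun z => h0 _)).
apply: eq_mixed_norm => [//|t]; congr h; apply: funext => i.
case: (unliftP ord0 i) => [l|] ->; last by rewrite insert_at_eq.
by rewrite insert_at_lift tnthS.
Qed.

End mixed_norm_theory.

(** * Removing the weights of all coordinates *)

(** The weights are removed one coordinate at a time, and the estimates for all
    outer coordinates [k] have to be carried along: removing the weights of the
    coordinate [i0] uses duality when [k = i0], and the estimate just obtained for
    [i0] serves as the second hypothesis of [lnorm_swap_sum] when [k != i0].  The
    hypothesis on [sigma] keeps the outer exponent at most one, that is, at most
    the inner one. *)
Lemma lnorm_remove_weights (R : realType) (m n : nat) (kappa : 'I_m -> R)
    (a : {ffun 'I_m -> 'I_n} -> R) (sigma L : R) :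
  0 < sigma -> (forall i, 0 <= kappa i) -> 1 <= sigma^-1 - \sum_i kappa i ->
  (forall J, 0 <= a J) ->
  (forall u : 'I_m -> 'I_n -> R,
     (forall i j, 0 <= u i j) -> (forall i, \sum_j u i j <= 1) ->
     forall k, lnorm sigma (fun j => \sum_(J : {ffun 'I_m -> 'I_n} | J k == j)
       (\prod_i u i (J i) `^ kappa i) * a J) <= L) ->
  forall k, lnorm (sigma^-1 - \sum_i kappa i)^-1
    (fun j => \sum_(J : {ffun 'I_m -> 'I_n} | J k == j) a J) <= L.
Proof.
move=> sigma0 kappa0 ge1 a0 H.
pose tail t := \sum_(i < m | (i < t)%N) kappa i.
have tail_le t : tail t <= \sum_i kappa i.
  by rewrite [leRHS](bigID (fun i : 'I_m => (i < t)%N))/= lerDl sumr_ge0.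
pose sg t := (sigma^-1 - tail t)^-1.
have sgV t : 1 <= (sg t)^-1.
  by rewrite invrK (le_trans ge1)// lerD2l lerN2.
have sg0 t : 0 < sg t by rewrite -invr_gt0 (lt_le_trans ltr01).
have sg1 t : sg t <= 1 by rewrite -[sg t]invrK invf_le1// invr_gt0.
(* The weights of the coordinates below t have been removed. *)
suff main t : (t <= m)%N -> forall u : 'I_m -> 'I_n -> R,
     (forall i j, 0 <= u i j) -> (forall i, \sum_j u i j <= 1) ->
     forall k, lnorm (sg t) (fun j => \sum_(J : {ffun 'I_m -> 'I_n} | J k == j)
       (\prod_(i < m | (t <= i)%N) u i (J i) `^ kappa i) * a J) <= L.
  have u1 (i : 'I_m) : \sum_(j < n) (0 : R) <= 1 by rewrite big1 ?ler01.
  move=> k; have := main m (leqnn m) (fun _ _ => 0) (fun _ _ => lexx _) u1 k.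
  rewrite /sg (_ : tail m = \sum_i kappa i); last first.
    by apply: eq_bigl => i; rewrite ltn_ord.
  apply: eq_lnorm_le => j.
  apply: eq_bigr => J _; rewrite big_pred0 ?mul1r// => i.
  by rewrite leqNgt ltn_ord.
elim: t => [_|t IH tm] u u0 u1 k.
  rewrite /sg /tail big_pred0// subr0 invrK.
  exact: H.
pose i0 := Ordinal tm.
pose b (J : {ffun 'I_m -> 'I_n}) :=
  (\prod_(i < m | (t < i)%N) u i (J i) `^ kappa i) * a J.
have b0 J : 0 <= b J.
  by rewrite mulr_ge0// prodr_ge0// => i _; exact: powR_ge0.
have Hw (v : 'I_n -> R) : (forall j, 0 <= v j) -> \sum_j v j <= 1 ->
    forall l, lnorm (sg t) (fun j => \sum_(J : {ffun 'I_m -> 'I_n} | J l == j)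
      v (J i0) `^ kappa i0 * b J) <= L.
  move=> v0 v1 l.
  have := IH (ltnW tm) (fun i => if i == i0 then v else u i).
  have v0' i j : 0 <= (if i == i0 then v else u i) j by case: eqP.
  have v1' i : \sum_j (if i == i0 then v else u i) j <= 1 by case: eqP.
  move=> /(_ v0' v1' l); apply: eq_lnorm_le => j.
  apply: eq_bigr => J _; rewrite (bigD1 i0)//= eqxx -mulrA; congr (_ * (_ * _)).
  apply: eq_big => [i|i ti].
    by rewrite -val_eqE/= ltn_neqAle andbC eq_sym.
  by case: (eqVneq i i0) ti => // ->; rewrite ltnn.
have sgS : (sg t.+1)^-1 = (sg t)^-1 - kappa i0.
  rewrite !invrK -addrA -opprD; congr (_ - _).
  rewrite /tail (bigD1 i0)/= ?leqnn// addrC; congr (_ + _).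
  by apply: eq_bigl => i; rewrite -val_eqE/= ltnS ltn_neqAle andbC.
have col : lnorm (sg t.+1)
    (fun j => \sum_(J : {ffun 'I_m -> 'I_n} | J i0 == j) b J) <= L.
  apply: (lnorm_dual (sg0 t) (sg0 t.+1) sgS (kappa0 i0)).
    by move=> j; apply: sumr_ge0.
  move=> v v0 v1; apply: eq_lnorm_le (Hw v v0 v1 i0) => j.
  by rewrite mulr_sumr; apply: eq_bigr => J /eqP ->.
have [->|ki0] := eqVneq k i0; first exact: col.
have split_sum (c : {ffun 'I_m -> 'I_n} -> R) j l l' :
    \sum_(J : {ffun 'I_m -> 'I_n} | J l == j) c J =
    \sum_j' \sum_(J : {ffun 'I_m -> 'I_n} | (J l == j) && (J l' == j')) c J.
  exact: (partition_big (fun J : {ffun 'I_m -> 'I_n} => J l') xpredT).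
rewrite (eq_lnorm _ (fun j => split_sum _ j k i0)).
apply: (lnorm_swap_sum (sg0 t) _ (sg1 _) sgS).
- by rewrite -lef_pV2 ?posrE// sgS lerBlDr lerDl.
- by move=> i j; apply: sumr_ge0 => J _; exact: b0.
- move=> v v0 v1; apply: eq_lnorm_le (Hw v v0 v1 k) => j.
  rewrite (split_sum _ _ _ i0).
  apply: eq_bigr => j' _; rewrite mulr_sumr.
  by apply: eq_bigr => J /andP[_ /eqP ->].
- move: col; rewrite (eq_lnorm _ (fun j => split_sum _ j i0 k)).
  apply: eq_lnorm_le => j.
  by apply: eq_bigr => j' _; apply: eq_bigl => J; rewrite andbC.
Qed.

(** * Multilinear maps and coordinatewise summability *)

Section multilinear_theory.
Variables (K : numFieldType) (n : nat) (E : lmodType K).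

Lemma multilinear_insert_at m (A : ('I_m.+1 -> 'rV[K]_n) -> E) k x :
  multilinear A -> multilinear (fun z => A (insert_at k x z)).
Proof.
move=> hA i z a y y'; have := hA (lift k i) (insert_at k x z) a y y'.
by rewrite !dfwith_insert_at_lift.
Qed.

Lemma linear_insert_at m (A : ('I_m.+1 -> 'rV[K]_n) -> E) k z :
  multilinear A -> linear (fun x => A (insert_at k x z)).
Proof.
move=> hA a y y'; have := hA k (insert_at k 0 z) a y y'.
by rewrite !dfwith_insert_at_eq.
Qed.

Lemma insert_at_scale m (A : ('I_m.+1 -> 'rV[K]_n) -> E) k a x z :
  multilinear A -> A (insert_at k (a *: x) z) = a *: A (insert_at k x z).
Proof.
move=> /(linear_insert_at k z) hA.
have A0 : A (insert_at k 0 z) = 0.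
  have := hA 1 0 0; rewrite !scale1r addr0 => /eqP.
  by rewrite -subr_eq subrr => /eqP.
by have := hA a x 0; rewrite A0 !addr0.
Qed.

Lemma insert_at_sum m (A : ('I_m.+1 -> 'rV[K]_n) -> E) k z (I : finType)
    (a : I -> K) (x : I -> 'rV[K]_n) :
  multilinear A ->
  A (insert_at k (\sum_i a i *: x i) z) = \sum_i a i *: A (insert_at k (x i) z).
Proof.
move=> hA; have A0 : A (insert_at k 0 z) = 0.
  by rewrite -(scale0r (0 : 'rV_n)) insert_at_scale// scale0r.
elim: (index_enum I) => [|i s IH]; first by rewrite !big_nil.
by rewrite !big_cons (linear_insert_at k z hA) IH.
Qed.

(** Weights on the unit vectors become a product of weights on the coefficients
    of a multilinear map. *)
Lemma multilinear_scale m (A : ('I_m -> 'rV[K]_n) -> E) a z :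
  multilinear A -> A (fun i => a i *: z i) = (\prod_i a i) *: A z.
Proof.
elim: m A a z => [|m IH] A a z hA.
  by rewrite big_ord0 scale1r; congr A; apply: funext => -[].
rewrite -[LHS](congr1 A (insert_atK ord0 _)) insert_at_scale//.
rewrite (IH (fun z' => A (insert_at ord0 (z ord0) z')) (fun i => a (lift ord0 i))
  (fun i => z (lift ord0 i)) (multilinear_insert_at _ _ hA)).
by rewrite scalerA big_ord_recl insert_atK.
Qed.

End multilinear_theory.

Section coordwise.
Variables (R : realType) (k : RorC) (n : nat).
Local Notation K := (scalars R k).
Implicit Types (p : \bar R) (w u : 'I_n -> R).

Lemma recip_ge0 p : (1 <= p)%E -> 0 <= recip p.
Proof. by move=> p1; rewrite /recip fine_ge0// inve_ge0 (le_trans _ p1). Qed.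

Lemma lp_norm_le1 p u (x : 'rV[K]_n) : (1 <= p)%E ->
  (forall j, 0 <= u j) -> \sum_j u j <= 1 ->
  (forall j, rnorm (x 0 j : K^o) <= u j `^ recip p) -> lp_norm p x <= 1.
Proof.
case: p => [a| |]//=; rewrite /recip.
- rewrite lee_fin => a1 u0 u1 xu; have a0 : 0 < a by exact: lt_le_trans a1.
  rewrite inver gt_eqF//= in xu.
  apply: (@le_trans _ _ (1 `^ a^-1)); last by rewrite powR1.
  apply: ge0_ler_powR; rewrite ?nnegrE//.
  + by rewrite invr_ge0 ltW.
  + by apply: sumr_ge0 => i _; exact: powR_ge0.
  apply: le_trans u1; apply: ler_sum => i _.
  rewrite -[leRHS](@powRVK _ _ a)// ?gt_eqF//.
  by apply: ge0_ler_powR; rewrite ?nnegrE ?rnorm_ge0 ?powR_ge0 ?(ltW a0).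
- move=> _ u0 u1 xu; apply/bigmax_leP; split=> // i _.
  by have := xu i; rewrite invey/= powRr0.
Qed.

Definition sign_vector w (e : 'I_n -> bool) : 'rV[K]_n :=
  \row_j ((-1) ^+ e j * scal k (w j)).

Lemma sign_vectorE w e :
  sign_vector w e = \sum_j (-1) ^+ e j *: (scal k (w j) *: delta_mx 0 j).
Proof.
rewrite [LHS]row_sum_delta; apply: eq_bigr => j _.
by rewrite mxE scalerA.
Qed.

Lemma lp_norm_sign_vector p u e : (1 <= p)%E ->
  (forall j, 0 <= u j) -> \sum_j u j <= 1 ->
  lp_norm p (sign_vector (fun j => u j `^ recip p) e) <= 1.
Proof.
move=> p1 u0 u1; apply: (lp_norm_le1 p1 u0 u1) => j.
rewrite mxE (rnormZ ((-1) ^+ e j) (scal k (u j `^ recip p) : K^o)).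
by rewrite rnorm_sign mul1r rnorm_scal ger0_norm ?powR_ge0.
Qed.

(** Fixing one argument preserves this property with the same constant
    ([coordwise_summing_insert_at]), so it can serve as the hypothesis of an
    induction on the number of arguments, whereas the relation between [G] and a
    summing operator is used only once. *)
Definition coordwise_summing (F : normedModType K) m (p : 'I_m -> \bar R)
    (r L : R) (G : ('I_m -> 'rV[K]_n) -> F) : Prop :=
  forall z, (forall i, lp_norm (p i) (z i) <= 1) ->
  forall i, lnorm r (fun j => rnorm (G (dfwith z i (z i 0 j *: delta_mx 0 j)))) <= L.

Lemma coordwise_summing_insert_at (F : normedModType K) m (p : 'I_m.+1 -> \bar R)
    r L (G : ('I_m.+1 -> 'rV[K]_n) -> F) l x :
  lp_norm (p l) x <= 1 -> coordwise_summing p r L G ->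
  coordwise_summing (fun i => p (lift l i)) r L (fun z => G (insert_at l x z)).
Proof.
move=> px hG z pz i; have := hG (insert_at l x z) _ (lift l i).
rewrite insert_at_lift; under eq_lnorm do rewrite dfwith_insert_at_lift.
apply => j; case: (unliftP l j) => [j'|] ->.
  by rewrite insert_at_lift.
by rewrite insert_at_eq.
Qed.

Section cotype.
Variables (F : normedModType K) (q c : R).
Hypotheses (q1 : 1 <= q) (cotypeF : cotype_with q c F).
Let C := Num.sqrt 2 * Num.max c 0.

Let C0 : 0 <= C.
Proof. by rewrite mulr_ge0 ?sqrtr_ge0// le_max lexx orbT. Qed.

(** By linearity in one argument, a Rademacher sum of values of [G] at multiples
    of the unit vectors is the value of [G] at a vector of signed weights. *)
Lemma cotype_insert_at m (G : ('I_m.+1 -> 'rV[K]_n) -> F) l w z :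
  multilinear G ->
  lnorm q (fun j => rnorm (G (insert_at l (scal k (w j) *: delta_mx 0 j) z))) <=
  C * cube_avg (fun e => rnorm (G (insert_at l (sign_vector w e) z))).
Proof.
move=> hG.
have := cotype_L1 (fun j => G (insert_at l (scal k (w j) *: delta_mx 0 j) z)) cotypeF.
move/le_trans; apply; apply: ler_wpM2l => //; apply: le_cube_avg => e.
by rewrite sign_vectorE insert_at_sum.
Qed.

(** Cotype is applied to one coordinate after the other.  The average over signs
    that this produces is moved outside the remaining [l_q] norm and the outer
    [l_r] norm by Minkowski's inequality; since the [L_1] average is used, no
    further comparison of moments is needed.  The finite type [X] stands for the
    outer coordinate. *)
Lemma iterated_cotype (X : finType) m (g : X -> ('I_m -> 'rV[K]_n) -> F)
    (w : 'I_m -> 'I_n -> R) r L :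
  1 <= r -> (forall x, multilinear (g x)) ->
  (forall e : 'I_m -> 'I_n -> bool,
     lnorm r (fun x => rnorm (g x (fun i => sign_vector (w i) (e i)))) <= L) ->
  lnorm r (fun x => lnorm q (fun J : {ffun 'I_m -> 'I_n} =>
    rnorm (g x (fun i => scal k (w i (J i)) *: delta_mx 0 (J i))))) <= C ^+ m * L.
Proof.
move=> r1; have r0 : 0 < r := lt_le_trans ltr01 r1.
have q0 : 0 < q := lt_le_trans ltr01 q1.
elim: m g w L => [|m IH] g w L hg hL.
  rewrite expr0 mul1r; apply: eq_lnorm_le (hL (fun _ _ => false)) => x.
  rewrite (lnorm_ffun0 (h := fun J => rnorm (g x (fun i => scal k (w i (J i)) *:
    delta_mx 0 (J i)))) (fun i => False_rect _ (Bool.diff_false_true (ltn_ord i))) q0).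
    by congr (rnorm (g x _)); apply: funext => -[].
  by move=> J; exact: rnorm_ge0.
pose dl (J : 'I_m -> 'I_n) : 'I_m -> 'rV[K]_n :=
  fun i => scal k (w (lift ord0 i) (J i)) *: delta_mx 0 (J i).
pose g' e x z := g x (insert_at ord0 (sign_vector (w ord0) e) z).
have step x : lnorm q (fun J : {ffun 'I_m.+1 -> 'I_n} =>
      rnorm (g x (fun i => scal k (w i (J i)) *: delta_mx 0 (J i)))) <=
    C * cube_avg (fun e => lnorm q (fun J : {ffun 'I_m -> 'I_n} =>
      rnorm (g' e x (dl J)))).
  rewrite (lnorm_insert_at ord0 (fun J => rnorm (g x (fun i =>
    scal k (w i (J i)) *: delta_mx 0 (J i)))) q0) lnorm_swap//.
  apply: (@le_trans _ _ (lnorm q (fun J : {ffun 'I_m -> 'I_n} =>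
      C * cube_avg (fun e => rnorm (g' e x (dl J)))))).
    apply: le_lnorm => // [J|J]; first exact: lnorm_ge0.
    apply: eq_lnorm_le (cotype_insert_at ord0 (w ord0) (dl J) (hg x)) => j.
    congr (rnorm (g x _)); apply: funext => i.
    case: (unliftP ord0 i) => [i'|] ->; first by rewrite !insert_at_lift.
    by rewrite !insert_at_eq.
  rewrite lnormZ//; last by move=> J; apply: cube_avg_ge0 => e; exact: rnorm_ge0.
  apply: ler_wpM2l => //; apply: (lnorm_cube_avg q1) => e J.
  exact: rnorm_ge0.
apply: (@le_trans _ _ (lnorm r (fun x => C * cube_avg (fun e =>
    lnorm q (fun J : {ffun 'I_m -> 'I_n} => rnorm (g' e x (dl J))))))).
  by apply: le_lnorm => // x; exact: lnorm_ge0.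
rewrite lnormZ//; last by move=> x; apply: cube_avg_ge0 => e; exact: lnorm_ge0.
rewrite exprS -mulrA; apply: ler_wpM2l => //.
apply: (@le_trans _ _ (cube_avg (fun e => lnorm r (fun x =>
    lnorm q (fun J : {ffun 'I_m -> 'I_n} => rnorm (g' e x (dl J))))))).
  by apply: (lnorm_cube_avg r1) => e x; exact: lnorm_ge0.
rewrite -[leRHS](cube_avg_cst n); apply: le_cube_avg => e.
apply: (IH (g' e) (fun i => w (lift ord0 i))) => [x|e'].
  exact: multilinear_insert_at.
apply: eq_lnorm_le (hL (insert_at ord0 e e')) => x.
congr (rnorm (g x _)); apply: funext => i.
case: (unliftP ord0 i) => [i'|] ->; first by rewrite !insert_at_lift.
by rewrite !insert_at_eq.
Qed.

End cotype.
End coordwise.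

(** * Coordinatewise summing maps into a space of finite cotype *)

Section cotype_induction.
Variables (R : realType) (k : RorC) (n : nat).
Local Notation K := (scalars R k).
Variables (F : normedModType K) (q r c : R).
Hypotheses (q1 : 1 <= q) (r1 : 1 <= r) (cotypeF : cotype_with q c F).
Let C := Num.sqrt 2 * Num.max c 0.
Let q0 : 0 < q := lt_le_trans ltr01 q1.
Let r0 : 0 < r := lt_le_trans ltr01 r1.

Let C0 : 0 <= C.
Proof. by rewrite mulr_ge0 ?sqrtr_ge0// le_max lexx orbT. Qed.

Lemma coordwise_summing_ge0 m (p : 'I_m.+1 -> \bar R) L
    (G : ('I_m.+1 -> 'rV[K]_n) -> F) :
  (forall i, (1 <= p i)%E) -> coordwise_summing p r L G -> 0 <= L.
Proof.
move=> p1 /(_ (fun i => sign_vector k (fun j => 0 `^ recip (p i)) (fun=> false))).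
move=> H; apply: le_trans (H _ ord0); first exact: lnorm_ge0.
by move=> i; apply: (lp_norm_sign_vector _ (u := fun=> 0)); rewrite ?big1 ?ler01.
Qed.

(** The sum over the coordinates other than [l] is an [l_q] norm to the power [q],
    estimated by [iterated_cotype]; the hypothesis of that lemma is coordinatewise
    summability in the coordinate [l], all vectors of signed weights lying in the
    unit balls. The power [q] matches the normalization of
    [lnorm_remove_weights]. *)
Lemma coordwise_summing_weighted m (p : 'I_m.+1 -> \bar R) L
    (G : ('I_m.+1 -> 'rV[K]_n) -> F) (u : 'I_m.+1 -> 'I_n -> R) l :
  (forall i, (1 <= p i)%E) -> coordwise_summing p r L G -> multilinear G ->
  (forall i j, 0 <= u i j) -> (forall i, \sum_j u i j <= 1) ->
  lnorm (r / q) (fun j => \sum_(J : {ffun 'I_m.+1 -> 'I_n} | J l == j)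
    ((\prod_i u i (J i) `^ recip (p i)) * rnorm (G (fun i => delta_mx 0 (J i)))) `^ q)
  <= (C ^+ m * L) `^ q.
Proof.
move=> p1 hG mG u0 u1.
pose w i j := u i j `^ recip (p i).
pose sv (J : 'I_m.+1 -> 'I_n) : 'I_m.+1 -> 'rV[K]_n :=
  fun i => scal k (w i (J i)) *: delta_mx 0 (J i).
have svE (J : 'I_m.+1 -> 'I_n) :
    (\prod_i u i (J i) `^ recip (p i)) * rnorm (G (fun i => delta_mx 0 (J i))) =
    rnorm (G (sv J)).
  rewrite /sv multilinear_scale// rnormZ; congr (_ * _).
  have w0 : 0 <= \prod_i w i (J i) by apply: prodr_ge0 => i _; exact: powR_ge0.
  rewrite -[LHS](ger0_norm w0) -(rnorm_scal k); congr (rnorm _).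
  elim/big_ind2: _ => // [|x a y b <- <-]; first exact: scal1.
  exact: scalM.
pose B j := lnorm q (fun J : {ffun 'I_m -> 'I_n} => rnorm (G (sv (insert_at l j J)))).
apply: (@eq_lnorm_le _ _ _ _ _ (fun j => B j `^ q)) => [j|].
  transitivity (\sum_(J : {ffun 'I_m.+1 -> 'I_n} | pred1 j (J l)) rnorm (G (sv J)) `^ q).
    by apply: eq_bigr => J _; rewrite svE.
  rewrite (sum_insert_at l (pred1 j) (fun J => rnorm (G (sv J)) `^ q)) big_pred1_eq.
  by rewrite /B lnormK ?gt_eqF.
rewrite lnorm_powR ?gt_eqF// divfK ?gt_eqF//.
apply: ge0_ler_powR; rewrite ?nnegrE ?lnorm_ge0 ?(ltW q0)//.
  by rewrite mulr_ge0 ?exprn_ge0// (coordwise_summing_ge0 p1 hG).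
pose g j z := G (insert_at l (scal k (w l j) *: delta_mx 0 j) z).
apply: (@eq_lnorm_le _ _ _ _ _ (fun j => lnorm q (fun J : {ffun 'I_m -> 'I_n} =>
    rnorm (g j (fun i => scal k (w (lift l i) (J i)) *: delta_mx 0 (J i)))))) => [j|].
  apply: eq_lnorm => J; congr (rnorm (G _)); apply: funext => i.
  case: (unliftP l i) => [i'|] ->; first by rewrite /sv !insert_at_lift.
  by rewrite /sv !insert_at_eq.
apply: (iterated_cotype (g := g) (w := fun i => w (lift l i)) q1 cotypeF r1) => [j|e].
   exact: multilinear_insert_at.
have lpw i b : lp_norm (p i) (sign_vector k (w i) b) <= 1.
  exact: lp_norm_sign_vector.
have := hG (insert_at l (sign_vector k (w l) (fun=> false))
  (fun i => sign_vector k (w (lift l i)) (e i))) _ l.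
rewrite insert_at_eq.
under eq_lnorm do rewrite dfwith_insert_at_eq mxE expr0 mul1r.
apply=> i; case: (unliftP l i) => [i'|] ->; first by rewrite insert_at_lift.
by rewrite insert_at_eq.
Qed.

Lemma recip_tailS m (p : 'I_m.+1 -> \bar R) t :
  recip_tail p t.+1 = recip_tail (fun i => p (lift ord0 i)) t.
Proof. by rewrite /recip_tail big_mkcond big_ord_recl/= add0r -big_mkcond. Qed.

Lemma recip_tail0 m (p : 'I_m.+1 -> \bar R) :
  recip_tail p 0 = recip (p ord0) + recip_tail p 1.
Proof.
by rewrite recip_tailS /recip_tail big_ord_recl.
Qed.

Lemma recip_tail_anti m (p : 'I_m -> \bar R) s t : (forall i, (1 <= p i)%E) ->
  (s <= t)%N -> recip_tail p t <= recip_tail p s.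
Proof.
move=> p1 st; rewrite /recip_tail big_mkcond [leRHS]big_mkcond/=.
apply: ler_sum => i _; case: ifPn => ti; first by rewrite (leq_trans st ti).
by case: ifP => // _; exact: recip_ge0.
Qed.

(** All weights are removed except those of the first coordinate, which are
    counted as a part of the array.  The bound on [recip_tail p 1] says that the
    resulting outer exponent does not exceed [q]. *)
Lemma coordwise_summing_outer m (p : 'I_m.+1 -> \bar R) L
    (G : ('I_m.+1 -> 'rV[K]_n) -> F) (u : 'I_n -> R) :
  (forall i, (1 <= p i)%E) -> coordwise_summing p r L G -> multilinear G ->
  q^-1 <= r^-1 - recip_tail p 1 ->
  (forall j, 0 <= u j) -> \sum_j u j <= 1 ->
  lnorm (r^-1 - recip_tail p 1)^-1 (fun j => u j `^ recip (p ord0) *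
    lnorm q (fun J : {ffun 'I_m -> 'I_n} =>
      rnorm (G (fun i => delta_mx 0 (insert_at ord0 j J i))))) <= C ^+ m * L.
Proof.
move=> p1 hG mG qT u0 u1.
have L0 := coordwise_summing_ge0 p1 hG.
set l := (_ - _)^-1.
pose h (J : 'I_m.+1 -> 'I_n) := rnorm (G (fun i => delta_mx 0 (J i))).
have h0 J : 0 <= h J by exact: rnorm_ge0.
pose a (J : 'I_m.+1 -> 'I_n) := (u (J ord0) `^ recip (p ord0) * h J) `^ q.
have a0 J : 0 <= a J by exact: powR_ge0.
(* The exponent 0 makes the weights of the first coordinate equal to 1. *)
pose kappa i := if i == ord0 then 0 else q * recip (p i).
have kappa0 i : 0 <= kappa i.
  by rewrite /kappa; case: eqP => // _; rewrite mulr_ge0 ?recip_ge0// ltW.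
have sum_kappa : \sum_i kappa i = q * recip_tail p 1.
  rewrite big_ord_recl/= add0r recip_tailS /recip_tail mulr_sumr.
  exact: eq_bigr.
have lE : ((r / q)^-1 - \sum_i kappa i)^-1 = l / q.
  by rewrite sum_kappa invf_div -mulrBr invfM mulrC.
apply: (@eq_lnorm_le _ _ _ _ _ (fun j =>
    (\sum_(J : {ffun 'I_m.+1 -> 'I_n} | J ord0 == j) a J) `^ q^-1)) => [j|].
  rewrite (sum_insert_at ord0 (pred1 j)) big_pred1_eq.
  rewrite -(lnormZ q0 (powR_ge0 _ _)) => [|J]; last exact: rnorm_ge0.
  rewrite /lnorm; apply: (congr1 (fun x => x `^ q^-1)).
  apply: eq_bigr => J _.
  rewrite /a insert_at_eq.
  by [].
have qV0 : q^-1 != 0 by rewrite invr_eq0 gt_eqF.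
rewrite (lnorm_powR _ _ qV0).
have B0 : 0 <= C ^+ m * L by rewrite mulr_ge0 ?exprn_ge0.
rewrite -[leRHS](powRK B0 (lt0r_neq0 q0)).
apply: ge0_ler_powR; rewrite ?nnegrE ?lnorm_ge0 ?powR_ge0 ?invr_ge0 ?(ltW q0)//.
rewrite -lE; apply: lnorm_remove_weights => //.
- by rewrite divr_gt0.
- by rewrite sum_kappa invf_div -mulrBr mulrC -ler_pdivrMr// mul1r.
move=> v v0 v1 i.
pose v' i := if i == ord0 then u else v i.
have v'0 i' j : 0 <= v' i' j by rewrite /v'; case: eqP.
have v'1 i' : \sum_j v' i' j <= 1 by rewrite /v'; case: eqP.
apply: eq_lnorm_le (coordwise_summing_weighted i p1 hG mG v'0 v'1) => j.
apply: eq_bigr => J _; rewrite /a -/(h J) !big_ord_recl/=.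
rewrite [kappa ord0]/kappa [v' ord0]/v' eqxx powRr0 mul1r.
have -> : \prod_(i' < m) v (lift ord0 i') (J (lift ord0 i')) `^ kappa (lift ord0 i') =
    (\prod_(i' < m) v' (lift ord0 i') (J (lift ord0 i')) `^ recip (p (lift ord0 i'))) `^ q.
  rewrite prod_powR => [|i']; last exact: powR_ge0.
  by apply: eq_bigr => i' _; rewrite /kappa /v'/= mulrC powRrM.
rewrite -powRM ?mulr_ge0 ?prodr_ge0 ?powR_ge0//.
  by rewrite mulrA [X in (X * _) `^ q]mulrC.
by move=> i' _; exact: powR_ge0.
Qed.

(** Induction on the number of arguments.  If the tail [1/p_2 + .. + 1/p_m] is below
    [1/r - 1/q], or if there is a single argument, then all exponents but the first
    are [q] and [coordwise_summing_outer] applies.  Otherwise the exponents of the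
    inner norm are those of the theorem for [p_2, .., p_m], and the induction
    hypothesis is applied to [G] with a vector of signed weights as its first
    argument. *)
Lemma coordwise_summing_mixed_norm m (p : 'I_m.+1 -> \bar R) L
    (G : ('I_m.+1 -> 'rV[K]_n) -> F) (s : nat -> R) :
  r <= q -> (forall i, (1 <= p i)%E) -> coordwise_summing p r L G ->
  multilinear G -> r^-1 - q^-1 <= recip_tail p 0 < r^-1 ->
  (forall t, (t < m.+1)%N -> s t =
     if r^-1 - q^-1 <= recip_tail p t then (r^-1 - recip_tail p t)^-1 else q) ->
  mixed_norm s (fun t : m.+1.-tuple 'I_n =>
    rnorm (G (fun i => delta_mx 0 (tnth t i)))) <= C ^+ m * L.
Proof.
move=> rq; elim: m p L G s => [|m IH] p L G s p1 hG mG /andP[ge_d lt_r] sE.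
- pose h (J : 'I_1 -> 'I_n) := rnorm (G (fun i => delta_mx 0 (J i))).
  have T1 : recip_tail p 1 = 0 by rewrite recip_tailS /recip_tail big_ord0.
  have q_le : q^-1 <= r^-1 - recip_tail p 1.
    by rewrite T1 subr0 lef_pV2.
  rewrite mixed_normS sE// ge_d.
  apply: (@lnorm_dual _ _ (r^-1 - recip_tail p 1)^-1 _ (recip (p ord0))).
  + by rewrite invr_gt0 T1 subr0 invr_gt0.
  + by rewrite invr_gt0 subr_gt0.
  + by rewrite !invrK recip_tail0 opprD addrAC addrA.
  + exact: recip_ge0.
  + by move=> j; exact: rnorm_ge0.
  move=> u u0 u1.
  apply: eq_lnorm_le (coordwise_summing_outer p1 hG mG q_le u0 u1) => j.
  congr (_ * _).
  rewrite (lnorm_ffun0 (h := fun J => h (insert_at ord0 j J)) (tnth [tuple]) q0) => [|J];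
    last exact: rnorm_ge0.
  congr (rnorm (G _)); apply: funext => i.
  by rewrite ord1 insert_at_eq.
pose T1 := recip_tail p 1.
have tau0 : 0 <= recip (p ord0) by exact: recip_ge0.
have T1_lt : T1 < r^-1.
  by apply: le_lt_trans lt_r; rewrite recip_tail0 lerDr.
pose l := (r^-1 - T1)^-1.
have l0 : 0 < l by rewrite invr_gt0 subr_gt0.
have s0E : s 0%N = (r^-1 - recip_tail p 0)^-1 by rewrite sE// ge_d.
rewrite mixed_normS s0E.
have insE j (t : m.+1.-tuple 'I_n) :
    (fun i => delta_mx 0 (tnth [tuple of j :: t] i) : 'rV[K]_n) =
    insert_at ord0 (delta_mx 0 j) (fun i => delta_mx 0 (tnth t i)).
  apply: funext => i; case: (unliftP ord0 i) => [i'|] ->.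
    by rewrite insert_at_lift tnthS.
  by rewrite insert_at_eq.
apply: (@lnorm_dual _ _ l _ (recip (p ord0))) => //.
+ by rewrite invr_gt0 subr_gt0.
+ by rewrite !invrK recip_tail0 opprD addrAC addrA.
+ by move=> j; apply: mixed_norm_ge0 => t; exact: rnorm_ge0.
move=> u u0 u1.
have [d_le|T1_lt_d] := leP (r^-1 - q^-1) T1; last first.
- have q_le : q^-1 <= r^-1 - recip_tail p 1 by rewrite -/T1; lra.
  apply: eq_lnorm_le (coordwise_summing_outer p1 hG mG q_le u0 u1) => j.
  congr (_ * _).
  rewrite -(mixed_norm_cst (h := fun J => rnorm (G (fun i =>
    delta_mx 0 (insert_at ord0 j J i)))) q0) => [|z]; last exact: rnorm_ge0.
  apply: eq_mixed_norm => [t tm|t].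
    rewrite sE ?ltnS// ifF//; apply/negbTE; rewrite -ltNge.
    by apply: le_lt_trans T1_lt_d; exact: recip_tail_anti.
  rewrite insE; congr (rnorm (G _)); apply: funext => i.
  case: (unliftP ord0 i) => [i'|] ->; first by rewrite !insert_at_lift.
  by rewrite !insert_at_eq.
pose s' t := s t.+1.
have s'E t : (t < m.+1)%N -> s' t = if r^-1 - q^-1 <= recip_tail p t.+1
    then (r^-1 - recip_tail p t.+1)^-1 else q.
  by move=> tm; rewrite /s' sE.
have tail_lt t : (0 < t)%N -> recip_tail p t < r^-1.
  by move=> t0; apply: le_lt_trans T1_lt; exact: recip_tail_anti.
have s'q t : (t < m.+1)%N -> q <= s' t.
  move=> tm; rewrite s'E//; case: ifPn => // h.
  rewrite -[q]invrK lef_pV2 ?posrE ?invr_gt0 ?subr_gt0 ?tail_lt//; lra.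
have s'_pos t : (t < m.+1)%N -> 0 < s' t.
  by move=> tm; exact: lt_le_trans (s'q _ tm).
have s'_anti t t' : (t <= t' < m.+1)%N -> s' t' <= s' t.
  move=> /andP[tt' t'm]; have tm := leq_ltn_trans tt' t'm.
  rewrite [s' t']s'E//; case: ifPn => [h|_]; last exact: s'q.
  have tail_le : recip_tail p t'.+1 <= recip_tail p t.+1 by exact: recip_tail_anti.
  rewrite s'E// (le_trans h tail_le) lef_pV2 ?posrE ?subr_gt0 ?tail_lt//.
  by rewrite lerD2l lerN2.
have s'0 : s' 0%N = l by rewrite s'E// d_le.
pose w j := u j `^ recip (p ord0).
pose x j : 'rV[K]_n := scal k (w j) *: delta_mx 0 j.
pose dl (t : m.+1.-tuple 'I_n) : 'I_m.+1 -> 'rV[K]_n := fun i => delta_mx 0 (tnth t i).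
pose f j t := rnorm (G (insert_at ord0 (x j) (dl t))).
apply: (@eq_lnorm_le _ _ _ _ _ (fun j => mixed_norm s' (f j))) => [j|].
  rewrite -(mixed_normZ s'_pos (powR_ge0 _ _)) => [|t]; last exact: rnorm_ge0.
  apply: eq_mixed_norm => // t; rewrite insE /f /x insert_at_scale// rnorm_scalZ//.
  exact: powR_ge0.
apply: (@le_trans _ _ (mixed_norm s' (fun t => lnorm q (fun j => f j t)))).
  apply: lnorm_mixed_norm_le => //.
  - by rewrite -s'0 s'q.
  - by move=> t tm; rewrite s'q//= -s'0 s'_anti.
  - by move=> j t; exact: rnorm_ge0.
pose G' e z := G (insert_at ord0 (sign_vector k w e) z).
apply: (@le_trans _ _ (mixed_norm s' (fun t =>
    C * cube_avg (fun e => rnorm (G' e (dl t)))))).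
  apply: le_mixed_norm => // t; first exact: lnorm_ge0.
  exact: cotype_insert_at.
have avg0 t : 0 <= cube_avg (fun e => rnorm (G' e (dl t))).
  by apply: cube_avg_ge0 => e; exact: rnorm_ge0.
rewrite (mixed_normZ s'_pos C0 avg0) exprS -mulrA; apply: ler_wpM2l => //.
apply: (@le_trans _ _ (cube_avg (fun e => mixed_norm s' (fun t => rnorm (G' e (dl t)))))).
  apply: (@mixed_norm_cube_avg _ _ _ _ _ (fun e t => rnorm (G' e (dl t)))) => [t tm|e t].
    exact: le_trans (s'q _ tm).
  exact: rnorm_ge0.
rewrite -[leRHS](cube_avg_cst n); apply: le_cube_avg => e.
apply: (IH (fun i => p (lift ord0 i))) => //.
- apply: coordwise_summing_insert_at hG.
  exact: lp_norm_sign_vector.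
- exact: multilinear_insert_at.
- by rewrite -recip_tailS d_le.
- by move=> t tm; rewrite -!recip_tailS s'E.
Qed.

End cotype_induction.

(** * Summing operators and the theorem *)

Section operators.
Variables (R : realType) (k : RorC) (n : nat).
Local Notation K := (scalars R k).

Lemma coord_le_lp_norm (p : \bar R) (x : 'rV[K]_n) j : (1 <= p)%E ->
  rnorm (x 0 j : K^o) <= lp_norm p x.
Proof.
case: p => [a| |]//= a1; last first.
  exact: (le_bigmax _ (fun i => rnorm (x 0 i : K^o))).
apply: (@le_coord_lnorm _ _ a (fun i => rnorm (x 0 i : K^o))); last exact: rnorm_ge0.
by rewrite (lt_le_trans ltr01)// -lee_fin.
Qed.

Lemma eq_lp_norm (p : \bar R) (x y : 'rV[K]_n) :
  (forall j, rnorm (x 0 j : K^o) = rnorm (y 0 j : K^o)) -> lp_norm p x = lp_norm p y.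
Proof.
move=> xy; case: p => [a| |]/=; [|exact: eq_bigr|exact: eq_bigr].
by apply: (congr1 (fun x => x `^ a^-1)); apply: eq_bigr => j _; rewrite xy.
Qed.

(** This makes the supremum in [mult_norm] an upper bound. *)
Lemma multilinear_bounded m (E : normedModType K) (A : ('I_m -> 'rV[K]_n) -> E) :
  multilinear A -> exists B, forall z : 'I_m -> 'rV[K]_n,
    (forall i j, rnorm (z i 0 j : K^o) <= 1) -> rnorm (A z) <= B.
Proof.
elim: m A => [|m IH] A hA.
  exists (rnorm (A (fun=> 0))) => z _.
  by rewrite (_ : z = fun=> 0)//; apply: funext => -[].
have [B HB] := fin_all_exists (fun j =>
  IH _ (multilinear_insert_at ord0 (delta_mx 0 j) hA)).
exists (\sum_j B j) => z z1.
rewrite -(insert_atK ord0 z) (row_sum_delta (z ord0)) insert_at_sum//.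
apply: le_trans (rnorm_sum _) _; apply: ler_sum => j _.
rewrite rnormZ (le_trans (ler_piMl (rnorm_ge0 _) (z1 ord0 j)))//.
by apply: HB => i j'.
Qed.

Lemma le_mult_norm m (E : normedModType K) (A : ('I_m -> 'rV[K]_n) -> E)
    (p : 'I_m -> \bar R) (z : 'I_m -> 'rV[K]_n) :
  (forall i, (1 <= p i)%E) -> multilinear A ->
  (forall i, lp_norm (p i) (z i) <= 1) -> rnorm (A z) <= mult_norm p A.
Proof.
move=> p1 hA z1; apply: ub_le_sup; last by exists z.
have [B HB] := multilinear_bounded hA.
exists B => _ [z' z'1 <-]; apply: HB => i j.
exact: le_trans (coord_le_lp_norm _ _ (p1 i)) (z'1 i).
Qed.

Lemma zero_dual_ball (E : normedModType K) : @dual_ball R k E (\0 : {linear E -> K^o}).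
Proof.
split; first exact: cst_continuous.
by move=> x; rewrite rnorm0 rnorm_ge0.
Qed.

Lemma weak_l1_ge0 (E : normedModType K) N (x : 'I_N -> E) : 0 <= weak_l1 x.
Proof.
apply: ub_le_sup.
  exists (\sum_j rnorm (x j)) => _ [phi [_ phi1] <-].
  by apply: ler_sum => j _; exact: phi1.
exists (\0 : {linear E -> K^o}); first exact: zero_dual_ball.
by rewrite big1// => j _; exact: rnorm0.
Qed.

(** The coefficients [t j] are chosen so that [t j * phi (x j)] is the absolute
    value of [phi (x j)]. *)
Lemma weak_l1_le (E : normedModType K) N (x : 'I_N -> E) (M : R) :
  (forall t : 'I_N -> K, (forall j, rnorm (t j : K^o) = 1) ->
     rnorm (\sum_j t j *: x j) <= M) ->
  weak_l1 x <= M.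
Proof.
move=> HM; apply: ge_sup.
  exists (\sum_(j < N) rnorm ((\0 : {linear E -> K^o}) (x j))).
  by exists (\0 : {linear E -> K^o}) => //; exact: zero_dual_ball.
move=> _ [phi [_ phi1] <-].
have [t Ht] := fin_all_exists2 (fun j => phaseP (phi (x j) : K)).
move=> tphi; apply: le_trans (HM t Ht); apply: le_trans (phi1 _).
rewrite linear_sum/=.
have -> : \sum_j phi (t j *: x j) = scal k (\sum_j rnorm (phi (x j))).
  rewrite (eq_bigr (fun j => scal k (rnorm (phi (x j))))).
    elim/big_ind2: _ => [|a b c d -> ->|//]; first by rewrite scal0.
    by rewrite scalD.
  by move=> j _; rewrite linearZ; exact: tphi.
rewrite rnorm_scal ger0_norm// sumr_ge0// => j _; exact: rnorm_ge0.
Qed.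

Lemma summing_coordwise_summing m (E F : normedModType K) (p : 'I_m.+1 -> \bar R)
    (r c : R) (A : ('I_m.+1 -> 'rV[K]_n) -> E) (v : E -> F) :
  (forall i, (1 <= p i)%E) -> 0 <= c -> summing_with r c v -> multilinear A ->
  coordwise_summing p r (c * mult_norm p A) (fun z => v (A z)).
Proof.
move=> p1 c0 hv hA z z1 i; apply: le_trans (hv _ _) _.
apply: ler_wpM2l => //; apply: weak_l1_le => t t1.
have dfE y : dfwith z i y = insert_at i y (fun j => z (lift i j)).
  by rewrite -[in LHS](insert_atK i z) dfwith_insert_at_eq.
under eq_bigr do rewrite dfE insert_at_scale// scalerA.
rewrite -insert_at_sum// -dfE; apply: le_mult_norm => // j.
have [->|ji] := eqVneq j i; last by rewrite dfwithout// eq_sym.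
rewrite dfwithin (le_trans _ (z1 i))// le_eqVlt; apply/orP; left; apply/eqP.
apply: eq_lp_norm => l; have -> : (\sum_i0 (t i0 * z i 0 i0) *: 'e_i0) 0 l = t l * z i 0 l.
  move=> R'; rewrite summxE (bigD1 l)//= big1 => [|l' ll'].
    by rewrite !mxE !eqxx mulr1 addr0.
  by rewrite !mxE eqxx/= eq_sym (negbTE ll') mulr0.
by rewrite (rnormZ (t l) (z i 0 l : K^o)) t1 mul1r.
Qed.

(** The tails decrease, so the indices up to [k0] are exactly those whose tail is
    at least [1/r - 1/q]. *)
Lemma s_expE m (p : 'I_m.+1 -> \bar R) (r q : R) t :
  (forall i, (1 <= p i)%E) -> r^-1 - q^-1 <= recip_tail p 0 -> (t < m.+1)%N ->
  s_exp p r q t =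
  if r^-1 - q^-1 <= recip_tail p t then (r^-1 - recip_tail p t)^-1 else q.
Proof.
move=> p1 d0 tm; rewrite /s_exp; congr (if _ then _ else _).
apply/idP/idP => [tk|dt]; last first.
  exact: (@leq_bigmax_cond _ (fun t : 'I_m.+1 => r^-1 - q^-1 <= recip_tail p t)
    (fun i : 'I_m.+1 => i : nat) (Ordinal tm)).
have [|i di ki] := eq_bigmax_cond (fun i : 'I_m.+1 => i : nat)
  (A := fun t : 'I_m.+1 => r^-1 - q^-1 <= recip_tail p t).
  by apply/card_gt0P; exists ord0.
apply: le_trans di _; apply: recip_tail_anti => //.
by rewrite -ki.
Qed.

End operators.

Lemma le_mul_inf (R : realType) (S : set R) (D X : R) :
  0 <= D -> S !=set0 -> (forall c, S c -> X <= D * c) -> X <= D * inf S.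
Proof.
rewrite le_eqVlt => /predU1P[<- [c Sc] /(_ c Sc)|D0 S0 H].
  by rewrite !mul0r.
rewrite mulrC -ler_pdivrMr//; apply: lb_le_inf => // c /H.
by rewrite ler_pdivrMr// mulrC.
Qed.

Theorem theorem1p7 (R : realType) (m : nat) (c : R) (hm : (2 <= m)%N) :
  exists C : R,
    forall (K : RorC) (p : 'I_m -> \bar R)
           (E F : completeNormedModType (scalars R K)) (q r : R),
      (forall i, (1 <= p i)%E) ->
      2 <= q ->
      cotype_with q c F ->
      1 <= r -> r <= q ->
      r^-1 - q^-1 <= \sum_(i < m) recip (p i) ->
      \sum_(i < m) recip (p i) < r^-1 ->
      forall (n : nat) (A : ('I_m -> 'rV[scalars R K]_n) -> E)
             (v : {linear E -> F}),
        (0 < n)%N ->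
        multilinear A ->
        abs_r1_summing r v ->
        mixed_norm (s_exp p r q)
          (fun j : m.-tuple 'I_n =>
             rnorm (v (A (fun i => delta_mx 0 (tnth j i)))))
        <= C * mult_norm p A * pi_r1 r v.
Proof.
case: m hm => [//|m] _; pose C := Num.sqrt 2 * Num.max c 0.
have C0 : 0 <= C by rewrite mulr_ge0 ?sqrtr_ge0// le_max lexx orbT.
exists (C ^+ m) => K p E F q r p1 q2 cotypeF r1 rq ge_d lt_r n A v _ hA [_ [c1 hc1]].
have q1 : 1 <= q by apply: le_trans q2; rewrite ler1n.
have tail0 : recip_tail p 0 = \sum_(i < m.+1) recip (p i) by [].
rewrite -tail0 in ge_d lt_r.
have A0 : 0 <= mult_norm p A.
  apply: le_trans (le_mult_norm (z := fun=> 0) p1 hA _); first exact: rnorm_ge0.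
  move=> i; apply: (lp_norm_le1 (u := fun=> 0)) => // [|j]; first by rewrite big1 ?ler01.
  by rewrite mxE rnorm0 powR_ge0.
rewrite /pi_r1; apply: le_mul_inf.
- by rewrite mulr_ge0 ?exprn_ge0.
- exists (Num.max c1 0); split; first by rewrite le_max lexx orbT.
  move=> N x; apply: le_trans (hc1 N x) _.
  by rewrite ler_wpM2r ?weak_l1_ge0// le_max lexx.
move=> c' [c'0 hv]; rewrite -mulrA (mulrC (mult_norm p A)).
apply: (coordwise_summing_mixed_norm q1 r1 cotypeF rq p1
  (summing_coordwise_summing p1 c'0 hv hA) (s := s_exp p r q)).
- by move=> i z a y y'; rewrite hA linearP.
- by rewrite ge_d lt_r.
- by move=> t tm; exact: s_expE.
Qed.
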